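(* Let $F$ be a connected graph with $e(F)>v(F)$. Then $D_\kappa(F)\ge \frac{e(F)}{v(F)}+2$.
   Context: Graphs are finite simple graphs; $v(F)$ and $e(F)$ denote the numbers of vertices and edges. A graph is $k$-connected if it has more than $k$ vertices, is connected, and remains connected after removal of any $k-1$ vertices; $\kappa(G)$ is the maximum $k$ such that $G$ is $k$-connected. We use first-order logic of graphs with relation symbols for adjacency and equality only. $D_\kappa(F)$ is the minimum quantifier depth of a first-order sentence $\Phi$ for which there is an integer $k$ such that for every connected graph $G$ with $\kappa(G)\ge k$, $G\models\Phi$ if and only if $G$ contains a (not necessarily induced) subgraph isomorphic to $F$. *)

(* Defs.v *)
From mathcomp Require Import all_boot all_order all_algebra.
Set Implicit Arguments. Unset Strict Implicit. Unset Printing Implicit Defensive.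

Record graph := Graph {
  gn : nat;
  gadj : rel 'I_gn;
  gsym : symmetric gadj;
  girr : irreflexive gadj }.

Definition nv (G : graph) : nat := gn G.
Definition ne (G : graph) : nat :=
  #|[set p : 'I_(gn G) * 'I_(gn G) | (val p.1 < val p.2)%N && gadj p.1 p.2]|.

Definition gconnected (G : graph) : Prop :=
  forall x y : 'I_(gn G), connect (@gadj G) x y.

Definition kconnected (G : graph) (k : nat) : Prop :=
  [/\ (k < gn G)%N, gconnected G &
      forall S : {set 'I_(gn G)}, (#|S| < k)%N ->
        forall x y, x \notin S -> y \notin S ->
          connect [rel a b | [&& gadj a b, a \notin S & b \notin S]] x y].

Definition contains (F G : graph) : Prop :=
  exists f : 'I_(gn F) -> 'I_(gn G),
    injective f /\ forall x y, gadj x y -> gadj (f x) (f y).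

Inductive fo : Type :=
| FAdj of nat & nat
| FEq of nat & nat
| FNot of fo
| FAnd of fo & fo
| FOr of fo & fo
| FEx of nat & fo
| FAll of nat & fo.

Fixpoint qd (phi : fo) : nat :=
  match phi with
  | FAdj _ _ | FEq _ _ => 0
  | FNot p => qd p
  | FAnd p q | FOr p q => maxn (qd p) (qd q)
  | FEx _ p | FAll _ p => (qd p).+1
  end.

Fixpoint fv (phi : fo) : seq nat :=
  match phi with
  | FAdj x y | FEq x y => [:: x; y]
  | FNot p => fv p
  | FAnd p q | FOr p q => fv p ++ fv q
  | FEx x p | FAll x p => filter (fun y => y != x) (fv p)
  end.

Definition sentence (phi : fo) : bool := nilp (fv phi).

Definition upd (T : Type) (env : nat -> T) (x : nat) (v : T) : nat -> T :=
  fun y => if y == x then v else env y.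

Fixpoint sat (G : graph) (env : nat -> 'I_(gn G)) (phi : fo) : Prop :=
  match phi with
  | FAdj x y => gadj (env x) (env y)
  | FEq x y => env x = env y
  | FNot p => ~ sat env p
  | FAnd p q => sat env p /\ sat env q
  | FOr p q => sat env p \/ sat env q
  | FEx x p => exists v : 'I_(gn G), sat (upd env x v) p
  | FAll x p => forall v : 'I_(gn G), sat (upd env x v) p
  end.

(* G |= phi (for sentences the environment is irrelevant whenever G is nonempty) *)
Definition models (G : graph) (phi : fo) : Prop :=
  forall env : nat -> 'I_(gn G), sat env phi.

Definition defines_containment_kappa (F : graph) (Phi : fo) (k : nat) : Prop :=
  forall G : graph, gconnected G -> kconnected G k ->
    (models G Phi <-> contains F G).

(* Main.v *)
Require Import Defs.
From mathcomp Require Import all_boot all_order all_algebra.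
From mathcomp Require Import zify ring lra.
Set Implicit Arguments. Unset Strict Implicit. Unset Printing Implicit Defensive.

(** Suppose [s * v(F) < e(F)] with [s >= 1].  Call a graph saturated if
    - any pattern of adjacencies to a bounded vertex set with at most [s]
      neighbours is realised by a new vertex,
    - every bounded vertex set [W] spans at most [s * |W| + O(1)] edges,
    - the common neighbourhood of any [s - 1] vertices contains a triangle.
    Duplicator wins the [s + 2]-round Ehrenfeucht-Fraisse game on two saturated
    graphs: besides the partial isomorphism she only has to preserve, for [s]
    chosen vertices, whether their common neighbourhood contains an edge, and,
    for [s + 1] chosen vertices, whether it is nonempty.  Both answers can be
    steered: the positive ones by the first and third properties, the negative
    ones because otherwise attaching vertices repeatedly would create a bounded
    set with too many edges.

    A random graph with edge probability [1/r] on [n = 8 L r^s] vertices, [L]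
    large but much smaller than [r], is saturated without the [O(1)] term and
    [k]-connected.  It contains no copy of [F], since [e(F) > s * v(F)], while
    planting a copy of [F] in it keeps it saturated and [k]-connected.  So no
    sentence of depth [s + 2] defines containment of [F]. *)

(** * Attaching vertices in saturated graphs *)

(** Two new vertices with [s] and [s + 1] earlier neighbours raise the degree sum by more than
    [2 * s] each on average; [c] is the old number of vertices. *)
Lemma two_step_excess s c d0 d1 d2 : d0 + 2 * s <= d1 -> d1 + 2 * s.+1 <= d2 ->
  d0 + 2 * s * (1 + (1 + c)) < d2 + 2 * s * c.
Proof. lia. Qed.

Lemma three_step_excess s c d0 d1 d2 d3 : d0 + 2 * s <= d1 -> d1 + 2 * s <= d2 ->
  d2 + 2 * s.+1 <= d3 -> d0 + 2 * s * (1 + (1 + (1 + c))) < d3 + 2 * s * c.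
Proof. lia. Qed.

Section Attachment.
Variables (V : finType) (e : rel V).
Hypotheses (esym : symmetric e) (eirr : irreflexive e).

Definition dominates (A : {set V}) (y : V) := [forall a in A, e y a].
Definition has_common_nbr (A : {set V}) := [exists y, dominates A y].
Definition has_common_edge (A : {set V}) :=
  [exists y, exists z, [&& dominates A y, dominates A z & e y z]].
Definition attached (W B : {set V}) (y : V) :=
  (y \notin W) && [forall a in W, e y a == (a \in B)].
(** Twice the number of edges spanned by [W], whence the factor 2 in [sparse_prop]. *)
Definition degree_sum (W : {set V}) := \sum_(x in W) #|[set y in W | e x y]|.

Definition extension_prop s K := forall W B : {set V},
  B \subset W -> #|B| <= s -> #|W| <= K -> exists y, attached W B y.
Definition sparse_prop s K E := forall W : {set V},
  #|W| <= K -> degree_sum W <= 2 * s * #|W| + E.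
Definition triangle_prop s := forall A : {set V}, #|A|.+1 = s ->
  exists x y z, [/\ dominates A x, dominates A y & dominates A z] /\
                [/\ e x y, e y z & e x z].

Lemma dominatesP (A : {set V}) y :
  reflect (forall a, a \in A -> e y a) (dominates A y).
Proof. exact: 'forall_implyP. Qed.

Lemma dominates_notin (A : {set V}) y : dominates A y -> y \notin A.
Proof.
by move/dominatesP => h; apply/negP => /h; rewrite eirr.
Qed.

Lemma dominatesU1 (A : {set V}) x y : dominates (x |: A) y = e y x && dominates A y.
Proof.
apply/dominatesP/andP => [h|[h1 /dominatesP h2] a].
  split; first by apply: h; rewrite setU11.
  by apply/dominatesP => a aA; apply: h; rewrite setU1r.
by rewrite in_setU1 => /orP[/eqP->|/h2].
Qed.

Lemma attachedP (W B : {set V}) y :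
  reflect (y \notin W /\ forall a, a \in W -> e y a = (a \in B)) (attached W B y).
Proof.
apply: (iffP andP) => -[h1 h2]; split=> //.
  by move=> a aW; apply/eqP; move/forall_inP: h2; apply.
by apply/forall_inP => a aW; rewrite h2.
Qed.

Lemma attached_full (A : {set V}) y : attached A A y = dominates A y.
Proof.
apply/attachedP/dominatesP => [[_ h] a aA|h]; first by rewrite h.
split; last by move=> a aA; rewrite h.
by apply/negP => /h; rewrite eirr.
Qed.

Lemma degree_sumU1 x (W : {set V}) : x \notin W ->
  degree_sum (x |: W) = degree_sum W + 2 * #|[set y in W | e x y]|.
Proof.
move=> xW; rewrite /degree_sum big_setU1 //=.
have -> : [set y in x |: W | e x y] = [set y in W | e x y].
  apply/setP => y; rewrite !inE; case: eqP => [->|] //=.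
  by rewrite eirr andbF.
have -> : \sum_(z in W) #|[set y in x |: W | e z y]| =
          \sum_(z in W) (e z x + #|[set y in W | e z y]|).
  apply: eq_bigr => z zW.
  have -> : [set y in x |: W | e z y] =
    (if e z x then x |: [set y in W | e z y] else [set y in W | e z y]).
    by apply/setP => y; case: ifP => h; rewrite !inE; case: eqP => [->|] //=;
       rewrite h ?andbF.
  by case: ifP => // h; rewrite cardsU1 inE (negbTE xW).
rewrite big_split /=.
have -> : \sum_(z in W) (e z x : nat) = #|[set y in W | e x y]|.
  rewrite -sum1dep_card big_mkcondr /=; apply: eq_bigr => z _.
  by rewrite esym; case: (e x z).
lia.
Qed.

Lemma degree_sum_ge x (W B : {set V}) : x \notin W -> B \subset W ->
  dominates B x -> degree_sum W + 2 * #|B| <= degree_sum (x |: W).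
Proof.
move=> xW sBW /dominatesP dB; rewrite degree_sumU1 // leq_add2l leq_mul2l /=.
apply: subset_leq_card; apply/subsetP => b bB.
by rewrite inE (subsetP sBW) // dB.
Qed.

Variables (s K E : nat).
Hypothesis ext : extension_prop s K.
Hypothesis spa : sparse_prop s K E.
Hypothesis tri : triangle_prop s.

(** Each step raises the excess [degree_sum W - 2 * s * #|W|] by at least one. It starts no lower
    than [- 2 * s * #|W0|], so [2 * s * #|W0| + E + 1] steps push it above [E], against sparsity;
    [K] leaves room for three new vertices per step. *)
Lemma no_dense_growth (W0 : {set V}) : #|W0| + 3 * (2 * s * #|W0| + E).+1 <= K ->
  (forall W : {set V}, W0 \subset W -> #|W| <= K -> exists W' : {set V},
    [/\ W \subset W', #|W'| <= #|W| + 3 &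
        degree_sum W + 2 * s * #|W'| < degree_sum W' + 2 * s * #|W|]) -> False.
Proof.
move=> leK step.
have H j : j <= (2 * s * #|W0| + E).+1 -> exists W : {set V},
    [/\ W0 \subset W, #|W| <= #|W0| + 3 * j &
        j + 2 * s * #|W| <= degree_sum W + 2 * s * #|W0|].
  elim: j => [_|j IH jJ]; first by exists W0; split => //; lia.
  have [W [sW cW dW]] := IH (ltnW jJ).
  have [|W' [sW' cW' dW']] := step W sW; first by lia.
  by exists W'; split; [exact: subset_trans sW sW'|lia|lia].
have [W [_ cW dW]] := H _ (leqnn _).
have := spa (W := W); lia.
Qed.

(** Vertices are added one by one, each attached with empty neighbourhood over all the earlier
    ones. *)
Lemma fresh_independent (A : {set V}) j : #|A| + j <= K ->
  exists W : {set V}, [/\ #|W| = j, [disjoint W & A],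
    forall w a, w \in W -> a \in A -> ~~ e w a &
    forall w w', w \in W -> w' \in W -> ~~ e w w'].
Proof.
elim: j => [_|j IH leK].
  by exists set0; rewrite cards0 disjoints_subset sub0set; split => // w ?; rewrite inE.
have [|W [cW dW hA hW]] := IH; first by lia.
have cWA : #|W :|: A| = #|A| + j.
  by rewrite cardsU (eqP (_ : W :&: A == set0)) ?setI_eq0 // cards0; lia.
have [|||y /attachedP[yW hy]] := ext (W := W :|: A) (B := set0).
- exact: sub0set.
- by rewrite cards0.
- by rewrite cWA; lia.
move: yW; rewrite inE negb_or => /andP[yW yA].
exists (y |: W); split.
- by rewrite cardsU1 yW cW.
- by rewrite disjoints_subset subUset sub1set inE yA -disjoints_subset.
- move=> w a; rewrite in_setU1 => /orP[/eqP->|] aA; last exact: hA.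
  by rewrite hy ?inE // aA orbT.
- move=> w w'; rewrite !in_setU1 => /orP[/eqP->|wW] /orP[/eqP->|wW'].
  + by rewrite eirr.
  + by rewrite hy ?inE // wW'.
  + by rewrite esym hy ?inE // wW.
  + exact: hW.
Qed.

Hypothesis s_gt0 : 0 < s.
(** Room for [no_dense_growth] started from at most [2 * s] vertices: [A] and a fresh set of at most
    [s] more. *)
Hypothesis leK : 2 * s + 3 * (2 * s * (2 * s) + E).+1 <= K.

Section Attach.
Variables A B : {set V}.
Hypothesis sBA : B \subset A.

(* The new vertices are attached to [B] and to the fresh set [W'], so as to have
   [s] neighbours already; a common neighbour is then one edge too many. *)
Lemma attach_no_common_nbr : #|A| = s ->
  exists2 y, attached A B y & ~~ has_common_nbr (y |: A).
Proof.
move=> cA; have cB : #|B| <= s by rewrite -cA subset_leq_card.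
have [/existsP[y /andP[? ?]]|/existsPn no] :=
  boolP [exists y, attached A B y && ~~ has_common_nbr (y |: A)]; first by exists y.
have [|W' [cW' dW' hA hW']] := fresh_independent (A := A) (j := s - #|B|).
  by rewrite cA; lia.
have cU : #|A :|: W'| <= 2 * s.
  by apply: leq_trans (leq_card_setU _ _).1 _; rewrite cA cW'; lia.
exfalso; apply: (@no_dense_growth (A :|: W')).
  by have := leq_mul (leqnn (2 * s)) cU; lia.
move=> W; rewrite subUset => /andP[sAW sWW] cW.
have cBW : #|B :|: W'| = s.
  rewrite cardsU (eqP (_ : B :&: W' == set0)) ?cards0; first by rewrite cW'; lia.
  by rewrite setI_eq0 disjoint_sym; apply: disjointWr dW'.
have sBWW : B :|: W' \subset W by rewrite subUset sWW (subset_trans sBA).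
have [|x /attachedP[xW hx]] := ext sBWW _ cW; first by rewrite cBW.
have xAB : attached A B x.
  apply/attachedP; split; first by apply: contraNN xW; apply/subsetP.
  move=> a aA; rewrite hx ?(subsetP sAW) // inE.
  by rewrite (disjointFl dW' aA) orbF.
have := no x; rewrite xAB negbK => /existsP[c]; rewrite dominatesU1 => /andP[cx cAd].
(* A neighbour of [x] in [W] lies in [B], hence in [A], which is disjoint from its dominating
   vertices, or in [W'], which has no edge to the nonempty set [A]. *)
have cNW : c \notin W.
  apply/negP => cW''; move: cx; rewrite esym hx // inE => /orP[cB'|cW3].
    by have := dominates_notin cAd; rewrite (subsetP sBA).
  have [a aA] : exists a, a \in A by apply/card_gt0P; rewrite cA.
  by have := hA _ _ cW3 aA; rewrite (dominatesP _ _ cAd).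
have xc : x != c by apply: contraTneq cx => ->; rewrite eirr.
(* [x] brings [s] edges to [W], and [c] brings [s + 1], to [A] and [x]. *)
exists (c |: (x |: W)).
have cxW : c \notin x |: W by rewrite in_setU1 negb_or eq_sym xc.
have dx : dominates (B :|: W') x.
  by apply/dominatesP => a aBW; rewrite hx ?(subsetP sBWW).
have := degree_sum_ge xW sBWW dx; rewrite cBW.
have := degree_sum_ge (x := c) (W := x |: W) (B := x |: A) cxW.
rewrite setUS // dominatesU1 cx cAd => /(_ isT isT).
have -> : #|x |: A| = s.+1.
  by rewrite cardsU1 cA; move/attachedP: xAB => [-> _].
rewrite cardsU1 cxW cardsU1 xW => h1 h2.
split; [|by rewrite !addnA addnC leq_add2l|exact: two_step_excess h2 h1].
exact: subset_trans (subsetUr _ _) (subsetUr _ _).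
Qed.

(* As above: [W'] is independent, so an edge in the common neighbourhood of
   [x |: A] has an end outside [W]. *)
Lemma attach_no_common_edge : #|A|.+1 = s ->
  exists2 y, attached A B y & ~~ has_common_edge (y |: A).
Proof.
move=> cA; have cB : #|B| < s by rewrite -cA ltnS subset_leq_card.
have [/existsP[y /andP[? ?]]|/existsPn no] :=
  boolP [exists y, attached A B y && ~~ has_common_edge (y |: A)]; first by exists y.
have [|W' [cW' dW' hA hW']] := fresh_independent (A := A) (j := s - #|B|).
  by lia.
have cU : #|A :|: W'| <= 2 * s.
  by apply: leq_trans (leq_card_setU _ _).1 _; rewrite cW'; lia.
exfalso; apply: (@no_dense_growth (A :|: W')).
  by have := leq_mul (leqnn (2 * s)) cU; lia.
move=> W; rewrite subUset => /andP[sAW sWW] cW.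
have cBW : #|B :|: W'| = s.
  rewrite cardsU (eqP (_ : B :&: W' == set0)) ?cards0; first by rewrite cW'; lia.
  by rewrite setI_eq0 disjoint_sym; apply: disjointWr dW'.
have sBWW : B :|: W' \subset W by rewrite subUset sWW (subset_trans sBA).
have [|x /attachedP[xW hx]] := ext sBWW _ cW; first by rewrite cBW.
have xA : x \notin A by apply: contraNN xW; apply/subsetP.
have xAB : attached A B x.
  apply/attachedP; split=> // a aA; rewrite hx ?(subsetP sAW) // inE.
  by rewrite (disjointFl dW' aA) orbF.
have dx : dominates (B :|: W') x.
  by apply/dominatesP => a aBW; rewrite hx ?(subsetP sBWW).
have inW c : c \in W -> e c x -> dominates A c -> c \in W'.
  move=> cW'' cx cAd; move: cx; rewrite esym hx // inE => /orP[cB'|//].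
  by have := dominates_notin cAd; rewrite (subsetP sBA).
have := degree_sum_ge xW sBWW dx; rewrite cBW.
have cxA : #|x |: A| = s by rewrite cardsU1 xA add1n.
have := no x; rewrite xAB negbK => /existsP[y /existsP[z]].
rewrite !dominatesU1 => /and3P[/andP[yx yA] /andP[zx zA] yz].
have yNx : y != x by apply: contraTneq yx => ->; rewrite eirr.
have zNx : z != x by apply: contraTneq zx => ->; rewrite eirr.
have [W1 W2] : W \subset x |: W /\ x |: A \subset x |: W.
  by rewrite subsetUr setUS.
wlog yW : y z yx yA zx zA yz yNx zNx / y \notin W.
  move=> h; have [yW|yW] := boolP (y \in W); last exact: (h y z).
  have [zW|zW] := boolP (z \in W); last by apply: (h z y) => //; rewrite esym.
  by have := hW' y z (inW _ yW yx yA) (inW _ zW zx zA); rewrite yz.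
have yxW : y \notin x |: W by rewrite in_setU1 negb_or yNx.
(* If [z] is old, [y] is adjacent to [A], [x] and [z], that is to [s + 1] vertices; otherwise [x],
   [y], [z] in turn bring [s], [s] and [s + 1] edges. *)
have [zW|zW] := boolP (z \in W).
  have zxA : z \notin x |: A by rewrite in_setU1 negb_or zNx dominates_notin.
  have := degree_sum_ge (x := y) (W := x |: W) (B := z |: (x |: A)) yxW.
  rewrite !dominatesU1 yx yA yz subUset W2 sub1set in_setU1 zW orbT.
  move=> /(_ isT isT); rewrite cardsU1 zxA cxA => h1 h2.
  exists (y |: (x |: W)); rewrite cardsU1 yxW cardsU1 xW.
  split; [|by rewrite !addnA addnC leq_add2l|exact: two_step_excess h2 h1].
  exact: subset_trans W1 (subsetUr _ _).
have zNy : z != y by apply: contraTneq yz => ->; rewrite eirr.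
have zyxW : z \notin y |: (x |: W) by rewrite !in_setU1 !negb_or zNx zNy.
have yxA : y \notin x |: A by rewrite in_setU1 negb_or yNx dominates_notin.
have := degree_sum_ge (x := y) (W := x |: W) (B := x |: A) yxW W2.
rewrite dominatesU1 yx yA => /(_ isT); rewrite cxA => h1.
have := degree_sum_ge (x := z) (W := y |: (x |: W)) (B := y |: (x |: A)) zyxW.
rewrite (setUS _ W2) !dominatesU1 zx zA esym yz => /(_ isT isT).
rewrite cardsU1 yxA cxA => h2 h3.
exists (z |: (y |: (x |: W))); rewrite cardsU1 zyxW cardsU1 yxW cardsU1 xW.
split; [|by rewrite !addnA addnC leq_add2l|exact: three_step_excess h3 h1 h2].
by apply: subset_trans W1 _; apply: subset_trans (subsetUr _ _) (subsetUr _ _).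
Qed.

(** A common neighbour [z] of [A] is fixed in advance and [y] is attached to it as well; [B != A]
    leaves room for this one further neighbour. *)
Lemma attach_common_nbr : #|A| = s -> B != A ->
  exists2 y, attached A B y & has_common_nbr (y |: A).
Proof.
move=> cA nBA; have cB : #|B| < s.
  by rewrite -cA proper_card // properEneq nBA.
have [||z] := ext (subxx A) _ _ ; [by rewrite cA|by rewrite cA; lia|].
rewrite attached_full => zA.
have zNA := dominates_notin zA.
have [|||y /attachedP[yW hy]] := ext (W := z |: A) (B := z |: B).
- exact: setUS.
- by rewrite cardsU1; case: (z \notin B); lia.
- by rewrite cardsU1 zNA cA; lia.
exists y.
  apply/attachedP; split; first by apply: contraNN yW; apply: setU1r.
  move=> a aA; rewrite hy; last exact: setU1r.
  rewrite in_setU1; case: eqP => // az.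
  by move: zNA; rewrite -az aA.
by apply/existsP; exists z; rewrite dominatesU1 zA esym hy ?setU11.
Qed.

(** If [B = A], a triangle in the common neighbourhood supplies a vertex with its opposite edge.
    Otherwise [B] has at most [s - 2] elements, so the new vertex can also be attached to both ends
    of an edge prepared in the common neighbourhood of [A]. *)
Lemma attach_common_edge : #|A|.+1 = s ->
  exists2 y, attached A B y & has_common_edge (y |: A).
Proof.
move=> cA; have [->|nBA] := eqVneq B A.
  have [x [y [z [[xA yA zA] [xy yz xz]]]]] := tri cA.
  exists x; first by rewrite attached_full.
  by apply/existsP; exists y; apply/existsP; exists z; rewrite !dominatesU1 yA zA yz
    !(esym _ x) xy xz.
have cB : #|B|.+1 < s.
  by rewrite -cA ltnS proper_card // properEneq nBA.
have [||y] := ext (subxx A) _ _ ; [by lia|by lia|].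
rewrite attached_full => yA; have yNA := dominates_notin yA.
have [||z] := ext (subxx (y |: A)) _ _; [by rewrite cardsU1 yNA; lia|
  by rewrite cardsU1 yNA; lia|].
rewrite attached_full => zyA; have zNyA := dominates_notin zyA.
have [|||x /attachedP[xW hx]] := ext (W := z |: (y |: A)) (B := z |: (y |: B)).
- by rewrite !setUS.
- by rewrite !cardsU1; case: (z \notin _); case: (y \notin _); lia.
- by rewrite !cardsU1 zNyA yNA; lia.
move: zyA zNyA; rewrite dominatesU1 in_setU1 negb_or => /andP[zy zA] /andP[_ zNA].
exists x.
  apply/attachedP; split.
    by apply: contraNN xW => xA; rewrite !setU1r.
  move=> a aA; rewrite hx; last by rewrite !setU1r.
  rewrite !in_setU1.
  case: eqP => [az|_]; first by move: zNA; rewrite -az aA.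
  by case: eqP => [ay|//]; move: yNA; rewrite -ay aA.
apply/existsP; exists z; apply/existsP; exists y.
rewrite !dominatesU1 zA yA zy !(esym _ x) !hx ?in_setU1 ?eqxx ?orbT //.
Qed.

End Attach.
End Attachment.

(** * The Ehrenfeucht-Fraisse game *)

Definition saturated (V : finType) (e : rel V) s K E :=
  [/\ extension_prop e s K, sparse_prop e s K E, triangle_prop e s &
      2 * s + 3 * (2 * s * (2 * s) + E).+1 <= K].

Definition swap (T1 T2 : Type) (p : T1 * T2) := (p.2, p.1).

(** With two rounds left Spoiler could exhibit a common edge, with one round left a common
    neighbour; hence the flags at sizes [s] and [s + 1]. *)
Definition position (V1 V2 : finType) (e1 : rel V1) (e2 : rel V2) s
    (P : seq (V1 * V2)) :=
  [/\ uniq (unzip1 P), uniq (unzip2 P),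
      {in P &, forall p q, e1 p.1 q.1 = e2 p.2 q.2},
      size P = s -> has_common_edge e1 [set:: unzip1 P] =
                    has_common_edge e2 [set:: unzip2 P] &
      size P = s.+1 -> has_common_nbr e1 [set:: unzip1 P] =
                       has_common_nbr e2 [set:: unzip2 P]].

Lemma position_swap (V1 V2 : finType) (e1 : rel V1) (e2 : rel V2) s P :
  position e1 e2 s P -> position e2 e1 s (map (@swap _ _) P).
Proof.
have u1 : unzip1 (map (@swap V1 V2) P) = unzip2 P by rewrite /unzip1 -map_comp.
have u2 : unzip2 (map (@swap V1 V2) P) = unzip1 P by rewrite /unzip2 -map_comp.
case=> h1 h2 h3 h4 h5; split; rewrite ?u1 ?u2 ?size_map //.
- move=> p q /mapP[p' p'P ->] /mapP[q' q'P ->] /=; exact/esym/h3.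
- by move/h4.
- by move/h5.
Qed.

Lemma uniq_map_inj (T1 T2 : eqType) (f : T1 -> T2) (l : seq T1) :
  uniq (map f l) -> {in l &, injective f}.
Proof.
elim: l => //= a l IH /andP[fa ul] x y; rewrite !inE.
case/orP => [/eqP->|xl] /orP[/eqP->|yl] // fxy; last exact: IH.
  by case/negP: fa; rewrite fxy map_f.
by case/negP: fa; rewrite -fxy map_f.
Qed.

Section Forth.
Variables (V1 V2 : finType) (e1 : rel V1) (e2 : rel V2).
Hypotheses (sym1 : symmetric e1) (irr1 : irreflexive e1).
Hypotheses (sym2 : symmetric e2) (irr2 : irreflexive e2).
Variables (s K E : nat).
Hypotheses (s_gt0 : 0 < s) (sat2 : saturated e2 s K E).

Lemma position_cons P v w (B : {set V2}) : position e1 e2 s P ->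
  v \notin unzip1 P -> attached e2 [set:: unzip2 P] B w ->
  {in P, forall p, e1 v p.1 = (p.2 \in B)} ->
  ((size P).+1 = s -> has_common_edge e1 (v |: [set:: unzip1 P]) =
                    has_common_edge e2 (w |: [set:: unzip2 P])) ->
  ((size P).+1 = s.+1 -> has_common_nbr e1 (v |: [set:: unzip1 P]) =
                    has_common_nbr e2 (w |: [set:: unzip2 P])) ->
  position e1 e2 s ((v, w) :: P).
Proof.
move=> [u1 u2 adj _ _] vP /attachedP[wP hw] hB hs hs1.
have hvw p : p \in P -> e1 v p.1 = e2 w p.2.
  by move=> pP; rewrite hB // hw // inE; apply: map_f.
split; rewrite /= ?vP ?u1 ?u2 ?set_cons //.
- by move: wP; rewrite inE => ->.
- move=> p q; rewrite !inE => /orP[/eqP->|pP] /orP[/eqP->|qP] /=.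
  + by rewrite irr1 irr2.
  + exact: hvw.
  + by rewrite sym1 sym2 hvw.
  + exact: adj.
Qed.

Lemma forth P v : position e1 e2 s P -> size P <= s.+1 -> v \notin unzip1 P ->
  exists w, position e1 e2 s ((v, w) :: P).
Proof.
move=> pos szP vP; have [u1 u2 adj hedge hnbr] := pos.
case: sat2 => ext spa tri leK.
set A1 := [set:: unzip1 P] in hedge hnbr; set A2 := [set:: unzip2 P] in hedge hnbr.
have cA1 : #|A1| = size P by rewrite cardsE (card_uniqP u1) size_map.
have cA2 : #|A2| = size P by rewrite cardsE (card_uniqP u2) size_map.
pose B : {set V2} := [set:: [seq p.2 | p <- P & e1 v p.1]].
have hB : {in P, forall p, e1 v p.1 = (p.2 \in B)}.
  move=> p pP; rewrite inE; apply/idP/mapP => [vp|[q]].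
    by exists p; rewrite // mem_filter vp.
  rewrite mem_filter => /andP[vq qP] pq.
  suff -> : p = q by [].
  exact: (uniq_map_inj u2).
have sBA : B \subset A2.
  apply/subsetP => x; rewrite !inE => /mapP[p]; rewrite mem_filter => /andP[_ pP] ->.
  exact: map_f.
have cB : #|B| <= size P by rewrite -cA2 subset_leq_card.
have fullB : (B == A2) = dominates e1 A1 v.
  apply/eqP/dominatesP => [BA a|h].
    by rewrite inE => /mapP[p pP ->]; rewrite hB // BA inE map_f.
  apply/eqP; rewrite eqEsubset sBA; apply/subsetP => x.
  by rewrite inE => /mapP[p pP ->]; rewrite -hB // h // inE map_f.
have := @position_cons P v _ B pos vP _ hB; rewrite -/A1 -/A2.
case: (ltngtP (size P).+1 s) => [lt|gt|eqs].
- have [|||w aw] := ext A2 B; [by []|clear -cB lt; lia|rewrite cA2; clear -lt leK; lia|].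
  by move=> h; exists w; apply: h => // eqs; clear -lt eqs; lia.
- have [eqs|nes] := eqVneq (size P) s; last first.
    (* Last round. A [v] adjacent to everything is answered through the flag on common neighbours;
       any other [v] asks for at most [s] adjacencies. *)
    have {}szP : size P = s.+1 by clear -szP gt nes; lia.
    have [BA|nBA] := eqVneq B A2.
      have : has_common_nbr e2 A2.
        by rewrite -hnbr //; apply/existsP; exists v; rewrite -fullB BA.
      case/existsP => w; rewrite -attached_full // -{2}BA => aw.
      by move=> h; exists w; apply: h => // eqs; clear -szP eqs; lia.
    have ltB : #|B| < s.+1 by rewrite -szP -cA2 proper_card // properEneq nBA.
    have [|||w aw] := ext A2 B; [by []|by []|rewrite cA2; clear -szP leK; lia|].
    by move=> h; exists w; apply: h => // eqs; clear -szP eqs; lia.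
  (* The move leads to [s + 1] vertices. If the flag is positive and [v] dominates [A1], then [v] is
     an end of an edge in the common neighbourhood of [A1], and the previous flag provides such an
     edge on the other side. *)
  have [bit|bit] := boolP (has_common_nbr e1 (v |: A1)); last first.
    have [|w aw bw] := attach_no_common_nbr sym2 irr2 ext spa s_gt0 leK sBA.
      by rewrite cA2.
    by move=> h; exists w; apply: h => // eqs'; [clear -eqs eqs'; lia|rewrite (negbTE bw)].
  have [BA|nBA] := eqVneq B A2.
    have : has_common_edge e2 A2.
      rewrite -hedge //; case/existsP: bit => y; rewrite dominatesU1 => /andP[yv yA].
      by apply/existsP; exists y; apply/existsP; exists v; rewrite yA yv -fullB BA eqxx.
    case/existsP => w /existsP[z /and3P[wA zA wz]] h; exists w; apply: h.
    + by rewrite BA attached_full.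
    + by move=> eqs'; clear -eqs eqs'; lia.
    + move=> _; apply/esym/existsP; exists z.
      by rewrite dominatesU1 sym2 wz.
  have [|w aw bw] := attach_common_nbr sym2 irr2 ext s_gt0 leK sBA _ nBA.
    by rewrite cA2.
  by move=> h; exists w; apply: h => // eqs'; clear -eqs eqs'; lia.
- have [bit|bit] := boolP (has_common_edge e1 (v |: A1)).
    have [|w aw bw] := attach_common_edge sym2 irr2 ext tri s_gt0 leK sBA.
      by rewrite cA2.
    by move=> h; exists w; apply: h => // eqs'; clear -eqs eqs'; lia.
  have [|w aw bw] := attach_no_common_edge sym2 irr2 ext spa s_gt0 leK sBA.
    by rewrite cA2.
  by move=> h; exists w; apply: h => // eqs'; [rewrite (negbTE bw)|clear -eqs eqs'; lia].
Qed.

End Forth.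

Section Game.
Variables (G H : graph) (s K E : nat).
Hypotheses (s_gt0 : 0 < s).
Hypotheses (satG : saturated (@gadj G) s K E) (satH : saturated (@gadj H) s K E).

(** A vertex chosen before leaves the position unchanged, so [Q] is only asked to contain [P]. *)
Lemma forth_any P v : position (@gadj G) (@gadj H) s P -> size P <= s.+1 ->
  exists w Q, [/\ position (@gadj G) (@gadj H) s Q, size Q <= (size P).+1,
    {subset P <= Q} & (v, w) \in Q].
Proof.
move=> pos szP; have [vP|vP] := boolP (v \in unzip1 P).
  have /mapP[[v' w] pP /= ->] := vP.
  by exists w, P; split.
have [w pos'] := forth (@gsym G) (@girr G) (@gsym H) (@girr H) s_gt0 satH pos szP vP.
by exists w, ((v, w) :: P); split; rewrite ?mem_head // => x xP; rewrite inE xP orbT.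
Qed.
End Game.

(** The entries of [P] and the quantifiers still to be read fit into [s + 2] rounds. Only free
    variables need their values in [P], so rebinding a variable is harmless. *)
Lemma position_sat (G H : graph) s K E : 0 < s ->
  saturated (@gadj G) s K E -> saturated (@gadj H) s K E ->
  forall phi P (env1 : nat -> 'I_(gn G)) (env2 : nat -> 'I_(gn H)),
    position (@gadj G) (@gadj H) s P -> size P + qd phi <= s.+2 ->
    (forall x, x \in fv phi -> (env1 x, env2 x) \in P) ->
    sat env1 phi <-> sat env2 phi.
Proof.
move=> s_gt0 satG satH.
have back P w : position (@gadj G) (@gadj H) s P -> size P <= s.+1 ->
    exists v Q, [/\ position (@gadj G) (@gadj H) s Q, size Q <= (size P).+1,
      {subset P <= Q} & (v, w) \in Q].
  move=> /position_swap pos szP.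
  have [|v [Q [posQ szQ sQ vQ]]] := forth_any s_gt0 satG w pos.
    by rewrite size_map.
  exists v, (map (@swap _ _) Q); split.
  - exact: position_swap.
  - by move: szQ; rewrite !size_map.
  - move=> [a b] abP; apply/mapP; exists (b, a) => //; apply: sQ.
    by apply/mapP; exists (a, b).
  - by apply/mapP; exists (w, v).
have upd_in (phi : fo) x P Q (env1 : nat -> 'I_(gn G)) (env2 : nat -> 'I_(gn H)) v w :
    (forall y, y \in [seq y <- fv phi | y != x] -> (env1 y, env2 y) \in P) ->
    {subset P <= Q} -> (v, w) \in Q ->
    forall y, y \in fv phi -> (upd env1 x v y, upd env2 x w y) \in Q.
  move=> hP sPQ vw y yphi; rewrite /upd; case: eqP => // yx.
  by apply: sPQ; apply: hP; rewrite mem_filter yphi andbT; apply/eqP.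
elim=> [x y|x y|p IHp|p IHp q IHq|p IHp q IHq|x p IHp|x p IHp] P env1 env2 pos /= sz hP.
- have [_ _ adj _ _] := pos.
  by rewrite (adj (env1 x, env2 x) (env1 y, env2 y)) //; apply: hP; rewrite !inE eqxx ?orbT.
- have [u1 u2 _ _ _] := pos.
  have hx : (env1 x, env2 x) \in P by apply: hP; rewrite !inE eqxx.
  have hy : (env1 y, env2 y) \in P by apply: hP; rewrite !inE eqxx ?orbT.
  split=> h.
    by have [] := uniq_map_inj u1 hx hy h.
  by have [] := uniq_map_inj u2 hx hy h.
- by have := IHp P env1 env2 pos sz hP; tauto.
- move: sz; rewrite addn_maxr geq_max => /andP[sz1 sz2].
  have h1 : sat env1 p <-> sat env2 p.
    apply: (IHp P) => //.
    by move=> x xp; apply: hP; rewrite mem_cat xp.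
  have h2 : sat env1 q <-> sat env2 q.
    apply: (IHq P) => //.
    by move=> x xp; apply: hP; rewrite mem_cat xp orbT.
  by tauto.
- move: sz; rewrite addn_maxr geq_max => /andP[sz1 sz2].
  have h1 : sat env1 p <-> sat env2 p.
    apply: (IHp P) => //.
    by move=> x xp; apply: hP; rewrite mem_cat xp.
  have h2 : sat env1 q <-> sat env2 q.
    apply: (IHq P) => //.
    by move=> x xp; apply: hP; rewrite mem_cat xp orbT.
  by tauto.
- have szP : size P <= s.+1.
    by rewrite -ltnS (leq_trans _ sz) // addnS ltnS leq_addr.
  have step Q v w : position (@gadj G) (@gadj H) s Q -> size Q <= (size P).+1 ->
      {subset P <= Q} -> (v, w) \in Q ->
      sat (upd env1 x v) p <-> sat (upd env2 x w) p.
    move=> posQ szQ sPQ vQ; apply: (IHp Q) => //; last exact: upd_in hP sPQ vQ.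
    by apply: leq_trans sz; rewrite addnS -addSn leq_add2r.
  split=> [[v hv]|[w hw]].
    have [w [Q [posQ szQ sPQ vQ]]] := forth_any s_gt0 satH v pos szP.
    by exists w; have := step _ _ _ posQ szQ sPQ vQ; tauto.
  have [v [Q [posQ szQ sPQ vQ]]] := back P w pos szP.
  by exists v; have := step _ _ _ posQ szQ sPQ vQ; tauto.
- have szP : size P <= s.+1.
    by rewrite -ltnS (leq_trans _ sz) // addnS ltnS leq_addr.
  have step Q v w : position (@gadj G) (@gadj H) s Q -> size Q <= (size P).+1 ->
      {subset P <= Q} -> (v, w) \in Q ->
      sat (upd env1 x v) p <-> sat (upd env2 x w) p.
    move=> posQ szQ sPQ vQ; apply: (IHp Q) => //; last exact: upd_in hP sPQ vQ.
    by apply: leq_trans sz; rewrite addnS -addSn leq_add2r.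
  split=> [hv w|hw v].
    have [v [Q [posQ szQ sPQ vQ]]] := back P w pos szP.
    by have := hv v; have := step _ _ _ posQ szQ sPQ vQ; tauto.
  have [w [Q [posQ szQ sPQ vQ]]] := forth_any s_gt0 satH v pos szP.
  by have := hw w; have := step _ _ _ posQ szQ sPQ vQ; tauto.
Qed.

Lemma saturated_models (G H : graph) s K E Phi : 0 < s ->
  saturated (@gadj G) s K E -> saturated (@gadj H) s K E ->
  sentence Phi -> qd Phi <= s.+2 -> models G Phi -> models H Phi.
Proof.
move=> s_gt0 satG satH fvP qdP mG env2.
have [extG _ _ leK] := satG.
(* Extension over the empty set gives a vertex of [G], hence an environment. *)
have [|||y0 _] := extG set0 set0; rewrite ?cards0 ?sub0set //.
have /(position_sat s_gt0 satG satH) : position (@gadj G) (@gadj H) s [::].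
  by case: (s) s_gt0.
move=> /(_ Phi (fun _ => y0) env2 qdP) [|h _]; last exact/h/mG.
by move: fvP; rewrite /sentence => /nilP -> x.
Qed.

(** * Product measures on finite function spaces *)

Section Probability.
Import GRing.Theory Num.Theory Order.TTheory.
Local Open Scope ring_scope.

Lemma bernoulli_le (x : rat) N : 0 <= x -> x <= 1 -> 1 - N%:R * x <= (1 - x) ^+ N.
Proof.
move=> x_ge0 x_le1; elim: N => [|N IH]; first by rewrite mul0r subr0 expr0.
have x1 : 0 <= 1 - x by rewrite subr_ge0.
rewrite exprS; apply: le_trans (ler_wpM2l x1 IH).
have hN : 0 <= N%:R :> rat by rewrite ler0n.
rewrite -[N.+1]add1n natrD; nra.
Qed.

(** A rational substitute for bounding a power of [1 - x] by an exponential. *)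
Lemma pow_compl_le (x : rat) N : 0 <= x -> x <= 1 ->
  (1 - x) ^+ N * (1 + N%:R * x) <= 1.
Proof.
move=> x_ge0 x_le1; elim: N => [|N IH]; first by rewrite mul0r addr0 expr0 mulr1.
apply: le_trans IH; rewrite exprS mulrAC -[leRHS]mulrC.
apply: ler_wpM2r; first by rewrite exprn_ge0 //; lra.
have hN : 0 <= N%:R :> rat by rewrite ler0n.
rewrite -[N.+1]add1n natrD; nra.
Qed.

(** Every block of [q] factors contributes at most one half, since [q * x >= 1]. *)
Lemma pow_compl_half (x : rat) q M N : 0 <= x -> x <= 1 ->
  (0 < q)%N -> q%:R^-1 <= x -> (q * M <= N)%N ->
  (1 - x) ^+ N <= 2^-1 ^+ M.
Proof.
move=> x_ge0 x_le1 q_gt0 qx leN.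
apply: le_trans (_ : (1 - x) ^+ (q * M) <= _).
  by apply: ler_wiXn2l leN; lra.
rewrite exprM; apply: lerXn2r; rewrite ?nnegrE ?exprn_ge0 //; [lra|].
have := pow_compl_le q x_ge0 x_le1.
have : 1 <= q%:R * x.
  have q0 : 0 < q%:R :> rat by rewrite ltr0n.
  by rewrite -[leLHS](mulfV (lt0r_neq0 q0)) ler_pM2l.
have : 0 <= (1 - x) ^+ q by rewrite exprn_ge0 //; lra.
set u := (1 - x) ^+ q; set v := q%:R * x; move=> *; nra.
Qed.

Section Space.
Variables (I T : finType) (t0 : T).
Notation Omega := {ffun I -> T}.
Implicit Types (f g : Omega) (E : Omega -> bool) (D : {set I}).

(** Under this counting measure the coordinates are independent and uniform on [T]; the value [t0]
    will mark a present edge. *)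
Definition pr E : rat := #|[set f | E f]|%:R / #|{: Omega}|%:R.

Lemma card_Omega_gt0 : 0 < #|{: Omega}|%:R :> rat.
Proof. by rewrite ltr0n; apply/card_gt0P; exists [ffun=> t0]. Qed.

Lemma pr_ge0 E : 0 <= pr E.
Proof. by rewrite divr_ge0 ?ler0n. Qed.

Lemma pr_le E E' : (forall f, E f -> E' f) -> pr E <= pr E'.
Proof.
move=> h; rewrite ler_pM2r ?invr_gt0 ?card_Omega_gt0 // ler_nat subset_leq_card //.
by apply/subsetP => f; rewrite !inE; apply: h.
Qed.

Lemma eq_pr E E' : E =1 E' -> pr E = pr E'.
Proof. by move=> h; rewrite /pr; under eq_finset do rewrite h. Qed.

Lemma prC E : pr (fun f => ~~ E f) = 1 - pr E.
Proof.
have O0 := lt0r_neq0 card_Omega_gt0.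
apply: (mulIf O0); rewrite mulrBl mul1r !divfK //.
have -> : [set f | ~~ E f] = ~: [set f | E f] by apply/setP => f; rewrite !inE.
by rewrite cardsCs setCK -cardsT natrB ?subset_leq_card ?subsetT // cardsT.
Qed.

Lemma pr_exists (J : finType) (P : pred J) (E : J -> Omega -> bool) :
  pr (fun f => [exists j in P, E j f]) <= \sum_(j in P) pr (E j).
Proof.
rewrite -mulr_suml ler_pM2r ?invr_gt0 ?card_Omega_gt0 // -natr_sum ler_nat.
have -> : [set f | [exists j in P, E j f]] = \bigcup_(j in P) [set f | E j f].
  apply/setP => f; rewrite inE; apply/exists_inP/bigcupP => -[j Pj Ej].
    by exists j; rewrite ?inE.
  by exists j => //; rewrite inE in Ej.
exact: (big_ind2 (fun (A : {set Omega}) n => #|A| <= n)%N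
  (eq_leq (cards0 _)) (fun A m B n hA hB =>
    leq_trans (leq_card_setU A B).1 (leq_add hA hB)) (fun _ _ => leqnn _)).
Qed.

(** Union bound in binary exponents: the choice of [j] costs [a] of the [b] bits of improbability
    and leaves [c]. *)
Lemma pr_exists_le (J : finType) (P : pred J) (E : J -> Omega -> bool) a b c :
  (#|P| <= 2 ^ a)%N -> (a + c <= b)%N ->
  (forall j, P j -> pr (E j) <= 2^-1 ^+ b) ->
  pr (fun f => [exists j in P, E j f]) <= 2^-1 ^+ c.
Proof.
move=> cP leb h; apply: le_trans (pr_exists _ _) _.
apply: le_trans (ler_sum _ h) _; rewrite sumr_const.
rewrite -[leLHS]mulr_natl.
apply: le_trans (_ : (2 ^ a)%:R * 2^-1 ^+ (a + c) <= _).
  apply: ler_pM; rewrite ?ler0n ?ler_nat //; first by rewrite exprn_ge0.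
  by apply: ler_wiXn2l leb; lra.
by rewrite exprD mulrA natrX -exprMn divff // expr1n mul1r.
Qed.

Definition depends D E := forall f g, {in D, f =1 g} -> E f = E g.

Definition mix D f g : Omega := [ffun i => if i \in D then f i else g i].

Lemma mixE D f g : {in D, mix D f g =1 f}.
Proof. by move=> i iD; rewrite ffunE iD. Qed.

Lemma mixNE D f g i : i \notin D -> mix D f g i = g i.
Proof. by move=> iD; rewrite ffunE (negbTE iD). Qed.

(** Exchanges the coordinates outside [D] of two functions; this bijection on pairs reduces
    independence and conditioning to counting. *)
Definition mix2 D (fg : Omega * Omega) := (mix D fg.1 fg.2, mix D fg.2 fg.1).

Lemma mix2K D : involutive (mix2 D).
Proof.
by move=> [f g]; congr pair; apply/ffunP => i; rewrite !ffunE /=;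
   case: (i \in D).
Qed.

Lemma card_mix2 D (P : pred (Omega * Omega)) :
  #|[set fg | P (mix2 D fg)]| = #|[set fg | P fg]|.
Proof.
rewrite -[in RHS](card_imset _ (inv_inj (mix2K D))); congr #|pred_of_set _|.
apply/setP => fg; rewrite inE; apply/idP/imsetP => [h|[fg']].
  by exists (mix2 D fg); rewrite ?inE // mix2K.
by rewrite inE => h ->; rewrite mix2K.
Qed.

(** Exchanging the coordinates outside [D] matches the pairs with [E] on the first and [E'] on the
    second function with those having both events on the first. *)
Lemma pr_indep D D' E E' : depends D E -> depends D' E' -> [disjoint D & D'] ->
  pr (fun f => E f && E' f) = pr E * pr E'.
Proof.
move=> dE dE' disj.
have h : (#|[set f | E f && E' f]| * #|{: Omega}| =
          #|[set f | E f]| * #|[set f | E' f]|)%N.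
  rewrite -!cardsT -!cardsX.
  have -> : setX [set f | E f] [set f | E' f] =
      [set fg | [pred p | E p.1 && E' p.2] fg] by apply/setP => p; rewrite !inE.
  rewrite -(card_mix2 D); congr #|pred_of_set _|; apply/setP => -[f g].
  rewrite !inE /= andbT; congr andb; first by apply: dE => i iD; rewrite mixE.
  by apply: dE' => i iD; rewrite mixNE // (disjointFl disj iD).
have O0 := lt0r_neq0 card_Omega_gt0.
by rewrite /pr mulrACA -natrM -h natrM; field; rewrite O0.
Qed.

(** Law of total probability, conditioning on the coordinates in [D]. *)
Lemma pr_mix D E b : (forall f, pr (fun g => E (mix D f g)) <= b) -> pr E <= b.
Proof.
move=> h; rewrite ler_pdivrMr ?card_Omega_gt0 //.
rewrite -(ler_pM2r card_Omega_gt0).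
have -> : #|[set f | E f]|%:R * #|{: Omega}|%:R =
    \sum_(f : Omega) #|[set g | E (mix D f g)]|%:R :> rat.
  rewrite -natrM -natr_sum; congr _%:R.
  rewrite -cardsT -cardsX.
  have -> : setX [set f | E f] setT = [set fg | [pred p : Omega * Omega | E p.1] fg].
    by apply/setP => p; rewrite !inE andbT.
  rewrite -(card_mix2 D) -sum1dep_card.
  rewrite -(pair_big_dep xpredT (fun f g => E (mix D f g)) (fun _ _ => 1%N)) /=.
  by apply: eq_bigr => f _; rewrite sum1dep_card.
apply: le_trans (_ : \sum_(f : Omega) b * #|{: Omega}|%:R <= _).
  by apply: ler_sum => f _; rewrite -ler_pdivrMr ?card_Omega_gt0 //; apply: h.
by rewrite sumr_const -[leLHS]mulr_natr.
Qed.

Lemma pr_true : pr (fun _ => true) = 1.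
Proof.
rewrite /pr (_ : [set f | true] = setT); last by apply/setP => f; rewrite !inE.
by rewrite cardsT divff // lt0r_neq0 ?card_Omega_gt0.
Qed.

Lemma dependsS D D' E : D \subset D' -> depends D E -> depends D' E.
Proof. by move=> sD dE f g h; apply: dE => i /(subsetP sD); apply: h. Qed.

Lemma dependsN D E : depends D E -> depends D (fun f => ~~ E f).
Proof. by move=> dE f g /dE ->. Qed.

Lemma depends_all (J : eqType) (l : seq J) D (E : J -> Omega -> bool) :
  {in l, forall j, depends D (E j)} -> depends D (fun f => all (fun j => E j f) l).
Proof. by move=> h f g fg; apply: eq_in_all => j jl; apply: h. Qed.

Lemma depends_and D E E' : depends D E -> depends D E' ->
  depends D (fun f => E f && E' f).
Proof. by move=> d d' f g h; rewrite (d f g) // (d' f g). Qed.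

Lemma pr_all (J : eqType) (l : seq J) (D : J -> {set I}) (E : J -> Omega -> bool) :
  uniq l -> {in l, forall j, depends (D j) (E j)} ->
  {in l &, forall i j, i != j -> [disjoint D i & D j]} ->
  pr (fun f => all (fun j => E j f) l) = \prod_(j <- l) pr (E j).
Proof.
elim: l => [|j l IH] /=; first by rewrite big_nil pr_true.
case/andP=> jl ul dE disj; rewrite big_cons.
pose D' := [set i | has (fun j => i \in D j) l].
rewrite -IH //; first last.
- by move=> i k il kl; apply: disj; rewrite inE ?il ?kl orbT.
- by move=> i il; apply: dE; rewrite inE il orbT.
apply: (@pr_indep (D j) D'); first by apply: dE; rewrite mem_head.
  apply: depends_all => i il; apply: dependsS (_ : D i \subset D') _.
    by apply/subsetP => k kD; rewrite inE; apply/hasP; exists i.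
  by apply: dE; rewrite inE il orbT.
rewrite disjoint_sym disjoints_subset; apply/subsetP => k; rewrite !inE => /hasP[i il ki].
have /(disjointFr (A := mem (D i))) : [disjoint D i & D j].
  apply: disj; rewrite ?mem_head ?inE ?il ?orbT //.
  by apply: contraNneq jl => <-.
by move=> /(_ k ki) ->.
Qed.

Lemma pr_all_le (J : finType) (Y : {set J}) (D : J -> {set I}) (E : J -> Omega -> bool) b :
  {in Y, forall j, depends (D j) (E j)} ->
  {in Y &, forall i j, i != j -> [disjoint D i & D j]} ->
  {in Y, forall j, pr (E j) <= b} ->
  pr (fun f => [forall j in Y, E j f]) <= b ^+ #|Y|.
Proof.
move=> dE disj hb.
rewrite (@eq_pr _ (fun f => all (fun j => E j f) (enum Y))); last first.
  move=> f; apply/forall_inP/allP => h j; first by rewrite mem_enum; apply: h.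
  by move=> jY; apply: h; rewrite mem_enum.
rewrite (pr_all (D := D)) ?enum_uniq //; first last.
- by move=> i j; rewrite !mem_enum; apply: disj.
- by move=> i; rewrite !mem_enum; apply: dE.
rewrite big_enum /= -prodr_const; apply: ler_prod => j jY.
by rewrite pr_ge0 hb.
Qed.

Lemma pr_coord i : pr (fun f => f i == t0) = #|T|%:R^-1.
Proof.
pose F j := if j == i then pred1 t0 else predT.
have T0 : #|T|%:R != 0 :> rat by rewrite pnatr_eq0 -lt0n; apply/card_gt0P; exists t0.
rewrite /pr; have -> : #|[set f : Omega | f i == t0]| = #|family F|.
  rewrite cardsE; apply: eq_card => f; rewrite inE; apply/idP/familyP => [h j|/(_ i)].
    by rewrite /F; case: eqP => [->|].
  by rewrite /F eqxx.
rewrite card_family card_ffun foldrE big_map big_enum /= (bigD1 i) //= {1}/F eqxx card1 mul1n.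
rewrite (eq_bigr (fun=> #|T|)); last by move=> j ji; rewrite /F (negbTE ji).
have I0 : (0 < #|I|)%N by apply/card_gt0P; exists i.
rewrite prod_nat_const cardC1 natrX natrX -{2}(prednK I0) exprS invfM mulrCA mulfV ?mulr1 //.
by rewrite expf_neq0.
Qed.

Lemma pr_zeros (D : {set I}) :
  pr (fun f => [forall i in D, f i == t0]) = #|T|%:R^-1 ^+ #|D|.
Proof.
rewrite (@eq_pr _ (fun f => all (fun j => f j == t0) (enum D))); last first.
  move=> f; apply/forall_inP/allP => h j; first by rewrite mem_enum; apply: h.
  by move=> jY; apply: h; rewrite mem_enum.
rewrite (pr_all (D := fun i => [set i])) ?enum_uniq //; first last.
- by move=> i j _ _; rewrite disjoints1 inE.
- by move=> i _ f g h; rewrite h ?inE.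
by rewrite big_enum /= -prodr_const; apply: eq_bigr => i _; rewrite pr_coord.
Qed.

Lemma pr_nonzeros (D : {set I}) :
  pr (fun f => [forall i in D, f i != t0]) = (1 - #|T|%:R^-1) ^+ #|D|.
Proof.
rewrite (@eq_pr _ (fun f => all (fun j => f j != t0) (enum D))); last first.
  move=> f; apply/forall_inP/allP => h j; first by rewrite mem_enum; apply: h.
  by move=> jY; apply: h; rewrite mem_enum.
rewrite (pr_all (D := fun i => [set i])) ?enum_uniq //; first last.
- by move=> i j _ _; rewrite disjoints1 inE.
- by move=> i _ f g h; rewrite h ?inE.
by rewrite big_enum /= -prodr_const; apply: eq_bigr => i _; rewrite prC pr_coord.
Qed.
End Space.
End Probability.

(** * Random graphs *)

Section Sets.
Variable V : finType.
Implicit Types (A B X Y : {set V}).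

(** Two-element sets will index the random edges; stars and crosses are the coordinates on which
    events depend. *)
Definition star x A : {set {set V}} := [set [set x; a] | a in A].
Definition cross X Y : {set {set V}} := [set [set p.1; p.2] | p in setX X Y].

Lemma set2_injr (x : V) : injective (fun a => [set x; a]).
Proof.
move=> a b /setP E; have := E a; rewrite !inE eqxx orbT => /esym/orP[/eqP ax|/eqP //].
by have := E b; rewrite !inE eqxx orbT ax orbb => /eqP.
Qed.

Lemma card_star x A : #|star x A| = #|A|.
Proof. by rewrite card_imset //; apply: set2_injr. Qed.

Lemma star_disjoint x y A B : x != y -> x \notin B -> [disjoint star x A & star y B].
Proof.
move=> xy xB; rewrite disjoints_subset; apply/subsetP => i /imsetP[a aA ->].
rewrite inE; apply/imsetP => -[b bB /setP/(_ x)]; rewrite !inE eqxx (negbTE xy) /=.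
by move/esym/eqP => xb; rewrite xb bB in xB.
Qed.

Lemma star_disjointr x A B : [disjoint A & B] -> [disjoint star x A & star x B].
Proof.
move=> dAB; rewrite disjoints_subset; apply/subsetP => i /imsetP[a aA ->].
rewrite inE; apply/imsetP => -[b bB /set2_injr ab].
by have := disjointFr dAB aA; rewrite ab bB.
Qed.

Lemma card_cross X Y : [disjoint X & Y] -> #|cross X Y| = (#|X| * #|Y|)%N.
Proof.
move=> dXY; rewrite card_in_imset ?cardsX // => -[x y] [x' y'].
rewrite !inE /= => /andP[xX yY] /andP[xX' yY'] E.
have xx' : x = x'.
  move/setP/(_ x): E; rewrite !inE eqxx /= => /esym/orP[/eqP//|/eqP xy].
  by have := disjointFr dXY xX; rewrite xy yY'.
by move: E; rewrite xx' => /set2_injr ->.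
Qed.

Lemma exists_subset (U : finType) (D : {set U}) m : m <= #|D| ->
  exists2 D' : {set U}, D' \subset D & #|D'| = m.
Proof.
move=> leD; exists [set x in take m (enum D)].
  by apply/subsetP => x; rewrite inE => /mem_take; rewrite mem_enum.
rewrite cardsE (card_uniqP _) ?take_uniq ?enum_uniq // size_take -cardE.
by case: ltngtP leD.
Qed.

Lemma card_small_sets nu m : #|V| <= 2 ^ nu ->
  #|[pred A : {set V} | #|A| <= m]| <= 2 ^ (nu.+1 * m).
Proof.
move=> cV; pose g (h : {ffun 'I_m -> option V}) := [set x | Some x \in codom h].
apply: leq_trans (_ : #|[set g h | h : {ffun 'I_m -> option V}]| <= _).
  apply: subset_leq_card; apply/subsetP => A; rewrite inE => cA.
  apply/imsetP; exists [ffun i : 'I_m => nth None (map Some (enum A)) i] => //.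
  apply/setP => x; rewrite inE; apply/idP/codomP => [xA|[i]].
    have ix : index x (enum A) < m.
      by apply: leq_trans cA; rewrite cardE index_mem mem_enum.
    exists (Ordinal ix); rewrite ffunE /= (nth_map x) ?nth_index ?mem_enum //.
    by rewrite index_mem mem_enum.
  rewrite ffunE; case: (ltnP i (size (enum A))) => hi.
    by rewrite (nth_map x) // => -[->]; rewrite -mem_enum mem_nth.
  by rewrite nth_default // size_map.
apply: leq_trans (leq_imset_card _ _) _.
rewrite card_ffun card_ord card_option expnM; case: m {g} => [|m].
  by rewrite !expn0.
by rewrite leq_exp2r // expnS mul2n -addnn -addn1 leq_add // expn_gt0.
Qed.
End Sets.

Section RandomGraph.
Import GRing.Theory Num.Theory Order.TTheory.
Local Open Scope ring_scope.
Variables (V T : finType) (t0 : T).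
Notation Omega := {ffun {set V} -> T}.
Implicit Types (f g : Omega) (A B X Y Z W : {set V}).
Notation p := (#|T|%:R^-1 : rat).

(** Indexing by vertex sets makes adjacency symmetric at once; coordinates other than pairs do not
    affect the graph. *)
Definition edge f : rel V := fun x y => (x != y) && (f [set x; y] == t0).

Lemma edge_sym f : symmetric (edge f).
Proof. by move=> x y; rewrite /edge eq_sym setUC. Qed.

Lemma edge_irr f : irreflexive (edge f).
Proof. by move=> x; rewrite /edge eqxx. Qed.

Lemma p_ge0 : 0 <= p.
Proof. by rewrite invr_ge0 ler0n. Qed.

Lemma cardT_gt0 : (0 < #|T|)%N.
Proof. by apply/card_gt0P; exists t0. Qed.

Lemma p_le1 : p <= 1.
Proof. by rewrite invf_le1 ?ltr0n ?ler1n cardT_gt0. Qed.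

Lemma dominates_edge f A y : y \notin A ->
  dominates (edge f) A y = [forall i in star y A, f i == t0].
Proof.
move=> yA; apply/dominatesP/forall_inP => [h i /imsetP[a aA ->]|h a aA].
  by have /andP[] := h a aA.
have ia : [set y; a] \in star y A by apply: imset_f.
by rewrite /edge h // andbT; apply: contraNneq yA => ->.
Qed.

Definition pattern A B y f :=
  [forall i in star y A, f i == t0] && [forall i in star y B, f i != t0].

Lemma depends_zeros (D : {set {set V}}) :
  depends D (fun f => [forall i in D, f i == t0]).
Proof. by move=> f g h; apply: eq_forallb_in => i iD; rewrite h. Qed.

Lemma depends_nonzeros (D : {set {set V}}) :
  depends D (fun f => [forall i in D, f i != t0]).
Proof. by move=> f g h; apply: eq_forallb_in => i iD; rewrite h. Qed.

Lemma depends_pattern A B y : depends (star y (A :|: B)) (pattern A B y).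
Proof.
apply: depends_and.
  by apply: dependsS (depends_zeros (D := _)); apply: imsetS; apply: subsetUl.
by apply: dependsS (depends_nonzeros (D := _)); apply: imsetS; apply: subsetUr.
Qed.

Lemma pr_pattern A B y : [disjoint A & B] ->
  pr (pattern A B y) = p ^+ #|A| * (1 - p) ^+ #|B|.
Proof.
move=> dAB; rewrite (pr_indep t0 (depends_zeros (D := star y A))
  (depends_nonzeros (D := star y B))) ?star_disjointr //.
by rewrite pr_zeros pr_nonzeros // !card_star.
Qed.

(** The stars of distinct vertices outside [A :|: B] are disjoint, so the failures are
    independent. *)
Lemma pr_no_pattern A B Y : [disjoint A & B] -> [disjoint Y & A :|: B] ->
  pr (fun f => [forall y in Y, ~~ pattern A B y f]) <=
  (1 - p ^+ #|A| * (1 - p) ^+ #|B|) ^+ #|Y|.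
Proof.
move=> dAB dY; apply: (pr_all_le t0 (D := fun y => star y (A :|: B))).
- by move=> y yY; apply/dependsN/depends_pattern.
- move=> x y xY yY xy; apply: star_disjoint => //.
  by apply: contraTN xY => xAB; rewrite (disjointFl dY xAB).
- by move=> y yY; rewrite prC // pr_pattern.
Qed.

(** Deleting a vertex deletes its star; coordinates that are not pairs can only increase the
    right-hand side. *)
Lemma degree_sum_edges f W :
  (degree_sum (edge f) W <= 2 * #|[set i in powerset W | f i == t0]|)%N.
Proof.
have [m] := ubnP #|W|; elim: m W => // m IH W cW.
have [->|[x xW]] := set_0Vmem W; first by rewrite /degree_sum big_set0.
rewrite -(setD1K xW) degree_sumU1 ?setD11 //; try exact: edge_sym; try exact: edge_irr.
set W' := W :\ x; have xW' : x \notin W' by rewrite setD11.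
have /IH h : (#|W'| < m)%N by move: cW; rewrite (cardsD1 x W) xW.
apply: leq_trans (leq_add h (leqnn _)) _; rewrite -mulnDr leq_mul2l /=.
set N := [set y in W' | edge f x y].
rewrite -(card_star x N) -cardsUI (eqP (_ : _ :&: _ == set0)) ?cards0 ?addn0.
  apply: subset_leq_card; rewrite subUset; apply/andP; split.
    apply/subsetP => i; rewrite !inE => /andP[iW ->]; rewrite andbT.
    exact: subset_trans iW (subsetUr _ _).
  apply/subsetP => i /imsetP[y]; rewrite !inE => /andP[yW /andP[_ xy]] ->.
  by rewrite xy andbT subUset !sub1set !inE eqxx yW orbT.
rewrite setI_eq0 disjoint_sym disjoints_subset; apply/subsetP => i /imsetP[y _ ->].
rewrite !inE subUset sub1set; apply/negP => /andP[/andP[xw _] _].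
by rewrite xw in xW'.
Qed.

(** Greedy choice: as long as [u] vertices are left they span an edge, whose ends are then
    removed. *)
Lemma exists_matching f X u m :
  ~~ [exists X : {set V} in [pred X : {set V} | #|X| == u],
       [forall i in [set i : {set V} | i \subset X & #|i| == 2], f i != t0]] ->
  (u + 2 * m <= #|X|)%N ->
  exists M : seq (V * V), [/\ size M = m, uniq (unzip1 M ++ unzip2 M),
    {in M, forall q, (q.1 \in X) && (q.2 \in X)} &
    {in M, forall q, edge f q.1 q.2}].
Proof.
move=> noX; elim: m X => [|m IH] X cX; first by exists [::].
have [|X' sX' cX'] := @exists_subset _ X u; first by apply: leq_trans cX; rewrite leq_addr.
have [x [y [xX yX xy]]] : exists x y, [/\ x \in X, y \in X & edge f x y].
  move/exists_inPn: noX => /(_ X'); rewrite inE cX' eqxx => /(_ isT).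
  case/forall_inPn => i; rewrite !inE => /andP[iX /cards2P[x [y [xy iE]]]].
  rewrite negbK iE => fi; exists x, y; split; rewrite /edge ?xy ?fi //;
  by apply: (subsetP sX'); apply: (subsetP iX); rewrite iE !inE eqxx ?orbT.
have [|M [szM uM XM eM]] := IH (X :\ x :\ y).
  have xNy : y != x by case/andP: xy; rewrite eq_sym.
  move: cX; rewrite (cardsD1 x X) xX (cardsD1 y (X :\ x)) !inE xNy yX; clear; lia.
have hM z : z \in unzip1 M ++ unzip2 M -> z \in X :\ x :\ y.
  by rewrite mem_cat => /orP[] /mapP[q /XM/andP[? ?] ->].
exists ((x, y) :: M); split=> //=.
- by rewrite szM.
- rewrite -(cat1s y) uniq_catCA /= uM andbT; apply/andP; split; last first.
    by apply/negP => /hM; rewrite !inE eqxx.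
  apply/negP; rewrite mem_cat inE.
  have xy' : x != y by case/andP: xy.
  rewrite (negbTE xy') /= -mem_cat => /hM; by rewrite !inE eqxx andbF.
- move=> q; rewrite inE => /orP[/eqP->|/XM]; first by rewrite xX.
  by rewrite !inE => /andP[/and3P[_ _ ->] /and3P[_ _ ->]].
- by move=> q; rewrite inE => /orP[/eqP->|/eM].
Qed.

Definition joined A (M : seq (V * V)) z f := [forall i in star z A, f i == t0] &&
  has (fun q => (f [set z; q.1] == t0) && (f [set z; q.2] == t0)) M.

Definition ends (M : seq (V * V)) : {set V} := [set:: unzip1 M ++ unzip2 M].

Lemma depends_join M z : depends (star z (ends M))
  (fun f => has (fun q => (f [set z; q.1] == t0) && (f [set z; q.2] == t0)) M).
Proof.
move=> f g h; apply: eq_in_has => q qM; rewrite !h //; apply: imset_f;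
  by rewrite inE mem_cat map_f ?orbT.
Qed.

Lemma depends_joined A M z : depends (star z (A :|: ends M)) (joined A M z).
Proof.
apply: depends_and.
  by apply: dependsS (depends_zeros (D := _)); apply: imsetS; apply: subsetUl.
by apply: dependsS (@depends_join M z); apply: imsetS; apply: subsetUr.
Qed.

(** All ends are distinct, so the members of [M] use disjoint pairs of coordinates and are missed
    independently. *)
Lemma pr_joined A M z : uniq (unzip1 M ++ unzip2 M) -> [disjoint A & ends M] ->
  pr (joined A M z) = p ^+ #|A| * (1 - (1 - p ^+ 2) ^+ size M).
Proof.
move=> uM dA.
have uM1 : uniq (unzip1 M) by move: uM; rewrite cat_uniq => /and3P[].
have uM2 : uniq (unzip2 M) by move: uM; rewrite cat_uniq => /and3P[].
have M12 q q' : q \in M -> q' \in M -> q.1 != q'.2.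
  move=> qM qM'; move: uM; rewrite cat_uniq => /and3P[_ /hasPn h _].
  by have := h _ (map_f snd qM'); apply: contraNneq => <-; apply: map_f.
rewrite (pr_indep t0 (depends_zeros (D := star z A)) (@depends_join M z)) ?star_disjointr //.
rewrite pr_zeros // card_star; congr (_ * _).
rewrite (@eq_pr _ _ _ (fun f => ~~ all
  (fun q => ~~ ((f [set z; q.1] == t0) && (f [set z; q.2] == t0))) M)); last first.
  by move=> f; rewrite -has_predC; apply: eq_has => q /=; rewrite negbK.
rewrite prC //; congr (1 - _).
pose D (q : V * V) := [set [set z; q.1]; [set z; q.2]].
have dD q : depends (D q)
    (fun f : Omega => ~~ ((f [set z; q.1] == t0) && (f [set z; q.2] == t0))).
  by move=> f g h; rewrite !h // !inE eqxx ?orbT.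
rewrite (pr_all t0 (D := D)) //; first last.
- move=> q q' qM qM' nqq'; rewrite disjoints_subset subUset !sub1set !inE !negb_or.
  have n1 : q.1 != q'.1 by apply: contraNneq nqq' => /(uniq_map_inj uM1 qM qM') ->.
  have n2 : q.2 != q'.2 by apply: contraNneq nqq' => /(uniq_map_inj uM2 qM qM') ->.
  have n12 := M12 q q' qM qM'; have n21 : q.2 != q'.1 by rewrite eq_sym M12.
  by rewrite !(inj_eq (@set2_injr _ z)) n1 n2 n12 n21.
- exact: (map_uniq uM1).
rewrite (eq_big_seq (fun=> 1 - p ^+ 2)) ?big_const_seq ?count_predT ?iter_mulr_1 //.
move=> q qM; rewrite prC // (pr_indep t0 (D := [set [set z; q.1]]) (D' := [set [set z; q.2]])).
- by rewrite !pr_coord expr2.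
- by move=> f g h; rewrite h ?inE.
- by move=> f g h; rewrite h ?inE.
- by rewrite disjoints1 inE (inj_eq (@set2_injr _ z)) M12.
Qed.

Definition good_matching A X f (M : seq (V * V)) :=
  uniq (unzip1 M ++ unzip2 M) &&
  all (fun q => [&& q.1 \in X, q.2 \in X, dominates (edge f) A q.1,
                    dominates (edge f) A q.2 & edge f q.1 q.2]) M.

Definition has_triangle A f := [exists x, exists y, exists z,
  [&& dominates (edge f) A x, dominates (edge f) A y, dominates (edge f) A z,
      edge f x y, edge f y z & edge f x z]].

(* Conditioning on the pairs inside [A :|: X] fixes the matching; the vertices
   outside then complete it to a triangle independently of each other. *)
Lemma pr_no_triangle A X m :
  pr (fun f => [exists M : m.-tuple (V * V), good_matching A X f M] &&
               ~~ has_triangle A f) <=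
  (1 - p ^+ #|A| * (1 - (1 - p ^+ 2) ^+ m)) ^+ #|~: (A :|: X)|.
Proof.
have p2 : 0 <= p ^+ 2 <= 1 by rewrite exprn_ge0 ?p_ge0 // exprn_ile1 ?p_ge0 ?p_le1.
apply: (pr_mix t0 (D := powerset (A :|: X))) => f.
set D := powerset _.
have inD x y : x \in A :|: X -> y \in A :|: X -> [set x; y] \in D.
  by move=> xU yU; rewrite inE subUset !sub1set xU yU.
have edge_in g x y : x \in A :|: X -> y \in A :|: X ->
    edge (mix D f g) x y = edge f x y.
  by move=> xU yU; rewrite /edge mixE // inD.
have dom_in g x : x \in X -> dominates (edge (mix D f g)) A x = dominates (edge f) A x.
  move=> xX; apply: eq_forallb_in => a aA; apply: edge_in; by rewrite inE ?xX ?aA ?orbT.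
have edge_out g x y : x \notin A :|: X -> y \in A :|: X ->
    edge (mix D f g) x y = (g [set x; y] == t0).
  move=> xU yU; rewrite /edge mixNE; last by rewrite inE subUset !sub1set (negbTE xU).
  by have -> : x != y by apply: contraNneq xU => ->.
have good_in g (M : seq (V * V)) : good_matching A X (mix D f g) M = good_matching A X f M.
  congr andb; apply: eq_all => q; case: (boolP (q.1 \in X)) => //= q1.
  case: (boolP (q.2 \in X)) => //= q2; rewrite !dom_in // edge_in // inE ?q1 ?q2 orbT //.
have [/existsP[M gM]|noM] := boolP [exists M : m.-tuple (V * V), good_matching A X f M];
  last first.
  (* Without a good matching the event is empty, and only the sign of the bound is to be checked. *)
  apply: le_trans (_ : 0 <= _).
    rewrite (@eq_pr _ _ _ (fun g => false)); last first.
      move=> g; apply: contraNF noM => /andP[/existsP[M gM] _].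
      by apply/existsP; exists M; rewrite -(good_in g).
    by rewrite /pr (_ : [set f | false] = set0) ?cards0 ?mul0r //; apply/setP => g; rewrite !inE.
  rewrite exprn_ge0 // subr_ge0 mulr_ile1 //.
  - by rewrite exprn_ge0 ?p_ge0.
  - by rewrite subr_ge0 exprn_ile1 // ?subr_ge0 ?gerBl; case/andP: p2.
  - by rewrite exprn_ile1 ?p_ge0 ?p_le1.
  - by rewrite gerBl exprn_ge0 // subr_ge0; case/andP: p2.
have /andP[uM /allP hM] := gM.
have dAM : [disjoint A & ends M].
  rewrite disjoint_sym disjoints_subset; apply/subsetP => x; rewrite !inE mem_cat.
  by case/orP => /mapP[q /hM/and5P[_ _ d1 d2 _] ->];
     [move: d1|move: d2]; apply: dominates_notin; apply: edge_irr.
have sMX : ends M \subset X.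
  apply/subsetP => x; rewrite inE mem_cat.
  by case/orP => /mapP[q /hM/and5P[q1 q2 _ _ _] ->].
apply: le_trans (pr_le t0 (E' := fun g => [forall z in ~: (A :|: X), ~~ joined A M z g]) _) _.
  move=> g /andP[_ noT]; apply/forall_inP => z; rewrite inE => zU.
  apply: contraNN noT => /andP[/forall_inP zA /hasP[q qM /andP[z1 z2]]].
  have /and5P[q1 q2 d1 d2 q12] := hM q qM.
  have [U1 U2] : q.1 \in A :|: X /\ q.2 \in A :|: X by rewrite !inE q1 q2 !orbT.
  apply/existsP; exists z; apply/existsP; exists q.1; apply/existsP; exists q.2.
  rewrite (dom_in _ q.1) // (dom_in _ q.2) // d1 d2.
  rewrite (edge_in _ q.1 q.2) // q12.
  rewrite (edge_out _ z q.1) // (edge_out _ z q.2) // z1 z2 !andbT.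
  apply/dominatesP => a aA; rewrite edge_out //; last by rewrite inE aA.
  by apply: zA; apply: imset_f.
apply: (pr_all_le t0 (D := fun z => star z (A :|: ends M))).
- by move=> z _; apply/dependsN/depends_joined.
- move=> x y; rewrite !in_setC => xU _ xy; apply: star_disjoint => //.
  by apply: contraNN xU; rewrite !in_setU => /orP[->//|/(subsetP sMX) ->]; rewrite orbT.
- by move=> z _; rewrite prC // pr_joined // size_tuple.
Qed.
End RandomGraph.

(** * Bad events and their probabilities *)

Section BadEvents.
Import GRing.Theory Num.Theory Order.TTheory.
(* [L = 2 ^ (tau - 3)] beats every polynomial in [nu], which serves all union
   bounds but the one over dense vertex sets: there a set of size [v] has
   [2 ^ (nu * v)] choices against probability [r ^- (s * v + 1)], so [r] must
   exceed [2 ^ (tau * K)]. *)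
Variables (V T : finType) (t0 : T) (s K k tau rho nu r L : nat).
Hypotheses (s_gt0 : 0 < s) (leK : s <= K) (big : (nu + k + K + s + 20) ^ 3 <= L).
Hypotheses (rhoE : rho = tau.+1 * K + 2 ^ K + K + 3) (nuE : nu = rho * s + tau).
Hypotheses (rE : r = 2 ^ rho) (cT : #|T| = r).
Hypotheses (card_V : #|V| = r ^ s * (8 * L)) (cV : #|V| = 2 ^ nu).
Notation Omega := {ffun {set V} -> T}.
Notation p := (#|T|%:R^-1 : rat)%R.
Notation edge := (edge t0).

Lemma r_gt0 : 0 < r.
Proof. by rewrite rE expn_gt0. Qed.

Lemma r_ge : 2 * K <= r.
Proof.
apply: leq_trans (_ : 2 ^ K.+1 <= _).
  by rewrite expnS leq_mul2l /= ltnW // ltn_expl.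
by rewrite rE leq_exp2l // rhoE; move: (2 ^ K) (tau.+1 * K) => a b; lia.
Qed.

Lemma rs_ge : r <= r ^ s.
Proof. by rewrite -{1}(expn1 r) leq_pexp2l // r_gt0. Qed.

Lemma rs_pred : r ^ s = r ^ s.-1 * r.
Proof. by rewrite -expnSr prednK. Qed.

Lemma bound2 : (nu + k + K + s + 20) * (nu + k + K + s + 20) <= L.
Proof. by apply: leq_trans big; rewrite mulnn leq_pexp2l // addnS. Qed.

Local Open Scope ring_scope.

Let p0 : 0 <= p := p_ge0 T.
Let p1 : p <= 1 := p_le1 t0.

Lemma pXs_le (x : rat) (A : {set V}) : (#|A| <= s)%N -> 2^-1 <= x ->
  (2 * r ^ s)%:R^-1 <= p ^+ #|A| * x.
Proof.
move=> cA hx; rewrite natrM invfM mulrC; apply: ler_pM => //.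
- by rewrite invr_ge0 ler0n.
- by apply: le_trans (ler_wiXn2l p0 p1 cA); rewrite cT natrX exprVn.
Qed.

Lemma half_pow_compl (m : nat) : (m <= K)%N -> 2^-1 <= (1 - p) ^+ m.
Proof.
move=> cm; apply: le_trans (bernoulli_le m p0 p1).
have r2 := r_ge; have hr : 0 < r%:R :> rat by rewrite ltr0n r_gt0.
have : m%:R * p <= 2^-1.
  rewrite cT ler_pdivrMr //.
  have : (2 * m)%:R <= r%:R :> rat by rewrite ler_nat (leq_trans _ r2) // leq_mul2l cm orbT.
  rewrite natrM; lra.
lra.
Qed.

Definition bad_extension (f : Omega) :=
  [exists AB in [pred AB : {set V} * {set V} |
     [&& (#|AB.1| <= s)%N, (#|AB.2| <= K)%N & [disjoint AB.1 & AB.2]]],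
   [forall y in ~: (AB.1 :|: AB.2), ~~ pattern t0 AB.1 AB.2 y f]].

(** A vertex realises the pattern with probability at least [1 / (2 * r ^ s)], and nearly
    [8 * L * r ^ s] vertices are available, so a given pattern is missed with probability at most
    [2 ^ (- 2 * L)]. *)
Lemma pr_bad_extension : pr bad_extension <= 2^-1 ^+ 3.
Proof.
apply: (pr_exists_le t0 (a := nu.+1 * K + nu.+1 * K) (b := 2 * L)).
- 
  rewrite expnD; have cs := card_small_sets K (eq_leq cV).
  apply: leq_trans (leq_mul cs cs); rewrite -cardX; apply: subset_leq_card.
  apply/subsetP => -[A B]; rewrite !inE /= => /and3P[cA cB _]; rewrite cB andbT.
  exact: leq_trans leK.
- by move: bound2; clear; nia.
case=> A B /and3P[/= cA cB dAB].
apply: le_trans (pr_no_pattern t0 dAB _) _.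
  by rewrite disjoints_subset subxx.
have hx := pXs_le cA (half_pow_compl cB).
have h1p : 0 <= 1 - p by rewrite subr_ge0.
apply: (pow_compl_half (q := 2 * r ^ s)) => //.
- by rewrite mulr_ge0 ?exprn_ge0.
- by rewrite mulr_ile1 ?exprn_ge0 ?exprn_ile1 // gerBl.
- by rewrite muln_gt0 expn_gt0 r_gt0.
rewrite cardsCs setCK card_V.
have cU : (#|A :|: B| <= 2 * K)%N.
  by apply: leq_trans (leq_card_setU _ _).1 _; rewrite mul2n -addnn leq_add // (leq_trans cA).
move: cU (leq_trans r_ge rs_ge) bound2; move: (r ^ s)%N #|_| => R u.
clear -s_gt0; set N := (nu + _ + _ + _ + _)%N => *; nia.
Qed.

(** Half of the vertices: matchings are sought inside [X0], the third vertices of triangles outside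
    it, so that the two choices use different coordinates. *)
Variable X0 : {set V}.
Hypothesis card_X0 : #|X0| = (r ^ s * (4 * L))%N.
(* With high probability there is no independent set of size [u] and any [s - 1]
   vertices have at least [c] common neighbours in [X0]; these then contain [r]
   disjoint edges. *)
Let u := (2 * r * (nu + 5) + 1)%N.
Let c := (u + 2 * r)%N.

(** [Z] stands for a small set covering the common neighbours in [X0]; once [A] and [Z] are fixed,
    [pr_no_pattern] applies. *)
Definition bad_common (f : Omega) :=
  [exists A in [pred A : {set V} | #|A|.+1 == s],
   [exists Z in [pred Z : {set V} | (#|Z| <= c)%N],
    [forall y in X0 :\: (A :|: Z), ~~ pattern t0 A set0 y f]]].

Lemma pr_bad_common : pr bad_common <= 2^-1 ^+ 3.
Proof.
apply: (pr_exists_le t0 (a := nu.+1 * s) (b := nu.+1 * s + 3)) (leqnn _) _.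
  apply: leq_trans (card_small_sets s (eq_leq cV)); apply: subset_leq_card.
  by apply/subsetP => A; rewrite !inE => /eqP <-.
move=> A /eqP cA.
apply: (pr_exists_le t0 (a := nu.+1 * c)) (card_small_sets _ (eq_leq cV)) (leqnn _) _.
move=> Z /= cZ; have dA0 : [disjoint A & set0] by rewrite disjoint_sym disjoints_subset sub0set.
apply: le_trans (pr_no_pattern t0 dA0 _) _.
  rewrite setU0 disjoint_sym disjoints_subset; apply/subsetP => a aA.
  by rewrite !inE aA.
rewrite cards0 expr0 mulr1.
apply: (pow_compl_half (q := (r ^ s.-1)%N)).
- by rewrite exprn_ge0.
- by rewrite exprn_ile1.
- by rewrite expn_gt0 r_gt0.
- by rewrite -cA /= natrX cT exprVn.
have : (#|X0| <= #|X0 :\: (A :|: Z)| + (s + c))%N.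
  rewrite -(cardsID (A :|: Z) X0) addnC leq_add2l.
  apply: leq_trans (subset_leq_card (subsetIr _ _)) _.
  by apply: leq_trans (leq_card_setU _ _).1 _; rewrite leq_add // -cA leqnSn.
rewrite card_X0 rs_pred.
have : (0 < r ^ s.-1)%N by rewrite expn_gt0 r_gt0.
move: bound2 r_ge r_gt0; rewrite /c /u; move: #|_| (r ^ s.-1)%N => w R.
move: leK; clear => leK h1 h2 h3 h4 h5.
set c := (2 * r * (nu + 5) + 1 + 2 * r)%N in h5 *.
have hc : (s + c <= r * (2 * nu + 14))%N by rewrite /c; nia.
(* The exponent needed is at most [r] times a quadratic in [nu], while [X0] offers [4 * L * r]
   blocks of [r ^ s.-1] vertices. *)
have hM : (nu.+1 * c + (nu.+1 * s + 3) + (s + c) <= r * (4 * L))%N.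
  apply: leq_trans (_ : r * ((nu + 2) * (2 * nu + 14) + 3) <= _)%N.
    have := leq_mul (leqnn (nu + 2)) hc; nia.
  by rewrite leq_mul2l; apply/orP; right; nia.
have E1 : (R * (nu.+1 * c + (nu.+1 * s + 3)) + R * (s + c) <= R * r * (4 * L))%N.
  by rewrite -mulnDr -mulnA leq_mul2l hM orbT.
rewrite -(leq_add2r (s + c)); apply: leq_trans h5; apply: leq_trans E1.
by rewrite leq_add2l leq_pmull.
Qed.

Definition bad_independent (f : Omega) :=
  [exists X : {set V} in [pred X : {set V} | #|X| == u],
   [forall i in [set i : {set V} | i \subset X & #|i| == 2], f i != t0]].

Lemma pr_bad_independent : pr bad_independent <= 2^-1 ^+ 3.
Proof.
apply: (pr_exists_le t0 (a := nu.+1 * u)) (leqnn _) _.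
  apply: leq_trans (card_small_sets u (eq_leq cV)); apply: subset_leq_card.
  by apply/subsetP => A; rewrite !inE => /eqP <-.
move=> X /eqP cX; rewrite pr_nonzeros // cards_draws cX.
apply: (pow_compl_half (q := r)) => //.
- exact: r_gt0.
- by rewrite cT.
(* The form of [u] makes this a multiple of [r]: each vertex of [X] yields [nu + 5] bits, against
   the [nu + 1] bits for choosing it. *)
have -> : ('C(u, 2) = r * (u * (nu + 5)))%N.
  rewrite bin2 {2}/u addn1 /= -mulnA mulnCA mul2n doubleK; clear; lia.
rewrite leq_mul2l; apply/orP; right; have : (0 < u)%N by rewrite /u addn1.
by clear; nia.
Qed.

Definition bad_triangle (f : Omega) :=
  [exists A in [pred A : {set V} | #|A|.+1 == s],
   [exists M : r.-tuple (V * V), good_matching t0 A X0 f M] && ~~ has_triangle t0 A f].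

Lemma pr_bad_triangle : pr bad_triangle <= 2^-1 ^+ 3.
Proof.
apply: (pr_exists_le t0 (a := nu.+1 * s) (b := L)).
- apply: leq_trans (card_small_sets s (eq_leq cV)); apply: subset_leq_card.
  by apply/subsetP => A; rewrite !inE => /eqP <-.
- by move: bound2; clear; nia.
move=> A /eqP cA; apply: le_trans (pr_no_triangle t0 A X0 r) _.
have hr : 0 < r%:R :> rat by rewrite ltr0n r_gt0.
have p2 : 0 <= p ^+ 2 by rewrite exprn_ge0.
have p2' : p ^+ 2 <= 1 by rewrite exprn_ile1.
have h1 : 0 <= (1 - p ^+ 2) ^+ r by rewrite exprn_ge0 // subr_ge0.
(* Since [r * p ^ 2 = p], a vertex is joined to both ends of one of [r] disjoint edges with
   probability at least [p / 2]. *)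
have h2 : (1 - p ^+ 2) ^+ r <= 1 - p / 2.
  have := pow_compl_le r p2 p2'.
  have -> : r%:R * p ^+ 2 = p by rewrite cT expr2 mulrA mulfV ?mul1r // lt0r_neq0.
  move: h1 p0 p1; set x := _ ^+ r; set y := p => *; nra.
apply: (pow_compl_half (q := (2 * r ^ s)%N)).
- by rewrite mulr_ge0 ?exprn_ge0 // subr_ge0 (le_trans h2) // gerBl divr_ge0.
- apply: mulr_ile1; [by rewrite exprn_ge0| |by rewrite exprn_ile1|by rewrite gerBl].
  by rewrite subr_ge0 (le_trans h2) // gerBl divr_ge0.
- by rewrite muln_gt0 expn_gt0 r_gt0.
- rewrite rs_pred natrM natrM invfM invfM -cT natrX -exprVn -cA /=.
  rewrite mulrCA; apply: ler_wpM2l; first by rewrite exprn_ge0.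
  move: h2; rewrite -cT; lra.
rewrite cardsCs setCK card_V.
have : (#|A :|: X0| <= s + r ^ s * (4 * L))%N.
  by apply: leq_trans (leq_card_setU _ _).1 _; rewrite card_X0 leq_add // -cA.
move: (leq_trans r_ge rs_ge) bound2 leK; move: (r ^ s)%N #|_| => R w; clear; nia.
Qed.

Definition bad_dense (f : Omega) :=
  [exists v in predT : pred 'I_K.+1,
   [exists W in [pred W : {set V} | #|W| == v],
    [exists D in [pred D : {set {set V}} | (D \subset powerset W) && (#|D| == (s * v).+1)],
     [forall i in D, f i == t0]]]].

Lemma pr_bad_dense : pr bad_dense <= 2^-1 ^+ 3.
Proof.
apply: (pr_exists_le t0 (a := K)) (leqnn _) _.
  by rewrite -(eq_card (A := 'I_K.+1)) // card_ord ltn_expl.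
move=> v _; apply: (pr_exists_le t0 (a := nu.+1 * v)) (leqnn _) _.
  apply: leq_trans (card_small_sets v (eq_leq cV)); apply: subset_leq_card.
  by apply/subsetP => A; rewrite !inE => /eqP <-.
move=> W /eqP cW.
apply: (pr_exists_le t0 (a := 2 ^ v) (b := rho * (s * v).+1)).
- apply: leq_trans (_ : #|powerset (powerset W)| <= _)%N; last by rewrite !card_powerset cW.
  by apply: subset_leq_card; apply/subsetP => D; rewrite !inE => /andP[].
- have hv : (v <= K)%N by rewrite -ltnS.
  have h2 : (2 ^ v <= 2 ^ K)%N by rewrite leq_exp2l.
  have h3 : (tau.+1 * v <= tau.+1 * K)%N by rewrite leq_mul2l hv orbT.
  (* The choice of [W] costs this many bits and [D] yields [rho * (s * v + 1)]; the surplus [rho],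
     from the one edge too many, pays for all the rest and dictates the value of [rho]. *)
  have E : (nu.+1 * v = rho * (s * v) + tau.+1 * v)%N by rewrite nuE -addnS mulnDl mulnA.
  have hrho : (2 ^ v + tau.+1 * v + K + 3 <= rho)%N.
    rewrite rhoE; move: h2 h3; move: (2 ^ v)%N (2 ^ K)%N (tau.+1 * _)%N (tau.+1 * _)%N.
    by clear; lia.
  rewrite E mulnS; move: hrho; move: (2 ^ v)%N (tau.+1 * v)%N (rho * (s * v))%N.
  by clear; lia.
move=> D /andP[_ /eqP cD].
by rewrite pr_zeros // cD cT rE natrX -exprVn -exprM.
Qed.

(** [X] is the smaller side of a cut by [S], hence the restriction to at most half of the
    vertices. *)
Definition bad_cut (f : Omega) :=
  [exists v in [pred v : 'I_(2 ^ nu).+1 | (0 < v)%N && (2 * v <= 2 ^ nu)%N],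
   [exists X in [pred X : {set V} | #|X| == v],
    [exists S in [pred S : {set V} | (#|S| <= k)%N],
     [forall i in cross X (~: (X :|: S)), f i != t0]]]].

Lemma pr_bad_cut : pr bad_cut <= 2^-1 ^+ 3.
Proof.
apply: (pr_exists_le t0 (a := nu.+1)) (leqnn _) _.
  apply: leq_trans (max_card _) _.
  by rewrite card_ord expnS mul2n -addnn -addn1 leq_add // expn_gt0.
move=> v /andP[v_gt0 v_le]; apply: (pr_exists_le t0 (a := nu.+1 * v)) (leqnn _) _.
  apply: leq_trans (card_small_sets v (eq_leq cV)); apply: subset_leq_card.
  by apply/subsetP => A; rewrite !inE => /eqP <-.
move=> X /eqP cX.
apply: (pr_exists_le t0 (a := nu.+1 * k)) (card_small_sets _ (eq_leq cV)) (leqnn _) _.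
move=> S /= cS; rewrite pr_nonzeros // card_cross; last first.
  rewrite disjoint_sym disjoints_subset; apply/subsetP => x; rewrite !inE negb_or.
  by case/andP.
apply: (pow_compl_half (q := r)) => //.
- exact: r_gt0.
- by rewrite cT.
have cU : (#|X :|: S| <= v + k)%N.
  by apply: leq_trans (leq_card_setU _ _).1 _; rewrite cX leq_add.
(* At least half of the vertices, minus [k], remain, so each vertex of [X] contributes [2 * L]
   blocks of [r] missing edges. *)
have hY : (r * (2 * L) <= #|~: (X :|: S)|)%N.
  have {}v_le : (2 * v <= r ^ s * (8 * L))%N by rewrite -card_V cV.
  rewrite cardsCs setCK card_V; move: v_le cU.
  move: rs_ge r_gt0 bound2; move: (r ^ s)%N #|_| (v : nat) => R w v'; clear.
  move=> h1 h2 h3 h4 h5.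
  have h6 : (r * (2 * L) <= R * (2 * L))%N by rewrite leq_mul2r h1 orbT.
  have h7 : (k <= R * L)%N by nia.
  lia.
have hM : (nu.+1 * k + (nu.+1 * v + (nu.+1 + 3)) <= v * (2 * L))%N.
  by move: bound2 v_gt0; move: (v : nat) => v'; clear; nia.
rewrite cX; apply: leq_trans (leq_mul (leqnn r) hM) _.
by rewrite mulnCA leq_mul2l hY orbT.
Qed.

(** Six events of probability at most [1 / 8] cannot cover the space. *)
Lemma exists_not_bad : exists f : Omega,
  ~~ [|| bad_extension f, bad_common f, bad_independent f, bad_triangle f,
         bad_dense f | bad_cut f].
Proof.
apply/existsP; apply: contraT => /existsPn allbad.
have pr_or E E' : pr (fun f : Omega => E f || E' f) <= pr E + pr E'.
  rewrite -mulrDl ler_pM2r ?invr_gt0 ?(card_Omega_gt0 _ t0) // -natrD ler_nat.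
  apply: leq_trans (leq_card_setU _ _).1; apply: subset_leq_card.
  by apply/subsetP => f; rewrite !inE.
have h : 1 <= pr (fun f : Omega => [|| bad_extension f, bad_common f, bad_independent f,
    bad_triangle f, bad_dense f | bad_cut f]).
  rewrite -[leLHS](pr_true {set V} t0); apply: (pr_le t0) => f _.
  by have := allbad f; rewrite negbK.
have {}pr_or E E' b : pr E <= 2^-1 ^+ 3 -> pr E' <= b ->
    pr (fun f : Omega => E f || E' f) <= 2^-1 ^+ 3 + b.
  by move=> h1 h2; apply: le_trans (pr_or _ _) _; apply: lerD.
have := le_trans h (pr_or _ _ _ pr_bad_extension (pr_or _ _ _ pr_bad_common
  (pr_or _ _ _ pr_bad_independent (pr_or _ _ _ pr_bad_triangle
  (pr_or _ _ _ pr_bad_dense pr_bad_cut))))).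
by rewrite !exprS expr0 !mulr1; lra.
Qed.

Local Close Scope ring_scope.

(** * Properties of a graph avoiding the bad events *)

Section Good.
Variable f : Omega.

Lemma good_extension : ~~ bad_extension f -> extension_prop (edge f) s K.
Proof.
move=> /exists_inPn good W B sBW cB cW.
have UW : B :|: (W :\: B) = W by rewrite -{1}(setIidPr sBW) setID.
have /good/forall_inPn[y] : (B, W :\: B) \in [pred AB : {set V} * {set V} |
     [&& #|AB.1| <= s, #|AB.2| <= K & [disjoint AB.1 & AB.2]]].
  rewrite inE /= cB (leq_trans _ cW) ?subset_leq_card ?subsetDl //=.
  by rewrite disjoint_sym disjoints_subset; apply/subsetP => x; rewrite !inE => /andP[].
rewrite in_setC negbK /= UW => yW /andP[/forall_inP yB /forall_inP yD].
exists y; apply/attachedP; split=> // a aW; rewrite /edge.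
have -> /= : y != a by apply: contraNneq yW => ->.
have [aB|aB] := boolP (a \in B); first by apply: yB; apply: imset_f.
by apply/negbTE; apply: yD; apply: imset_f; rewrite inE aB.
Qed.

Lemma good_sparse : ~~ bad_dense f -> sparse_prop (edge f) s K 0.
Proof.
move=> good W cW; rewrite addn0; apply: contraNT good; rewrite -ltnNge => dense.
have {}dense : (s * #|W|).+1 <= #|[set i in powerset W | f i == t0]|.
  have := leq_trans dense (degree_sum_edges t0 f W).
  by rewrite -mulnA ltn_pmul2l.
have [D sD cD] := exists_subset dense.
apply/exists_inP; exists (inord #|W|) => //; rewrite inordK ?ltnS //.
apply/exists_inP; exists W; first by rewrite inE.
apply/exists_inP; exists D.
  rewrite inE cD eqxx andbT; apply/subsetP => i /(subsetP sD).
  by rewrite inE => /andP[].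
by apply/forall_inP => i /(subsetP sD); rewrite inE => /andP[].
Qed.

(** At least [c = u + 2 * r] common neighbours in [X0] contain [r] disjoint edges, and such a
    matching forces a triangle. *)
Lemma good_triangle : ~~ bad_common f -> ~~ bad_independent f -> ~~ bad_triangle f ->
  triangle_prop (edge f) s.
Proof.
move=> /exists_inPn good1 good2 /exists_inPn good3 A cA.
have irr := @edge_irr _ _ t0 f.
pose C := [set y in X0 | dominates (edge f) A y].
have cC : c <= #|C|.
  rewrite leqNgt; apply/negP => ltC.
  have /good1/exists_inPn/(_ C) : A \in [pred A : {set V} | #|A|.+1 == s] by rewrite inE cA.
  rewrite inE ltnW // => /(_ isT)/forall_inPn[y].
  rewrite !inE negbK => /andP[]; rewrite negb_or => /andP[yA yC] yX /andP[yd _].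
  by move: yC; rewrite yX dominates_edge // yd.
have [M [szM uM MC Me]] := exists_matching good2 cC.
have /good3 : A \in [pred A : {set V} | #|A|.+1 == s] by rewrite inE cA.
case/nandP => [/existsPn noM|/negPn].
  case/negP: (noM (Tuple (introT eqP szM))); rewrite /good_matching uM; apply/allP => q qM.
  have := MC q qM; rewrite !inE => /andP[/andP[-> ->] /andP[-> ->]].
  by rewrite Me.
case/existsP => x /existsP[y /existsP[z]] /and3P[xA yA /and4P[zA xy yz xz]].
by exists x, y, z.
Qed.

(** The component [C] of [x] outside [S] and the rest of the vertices outside [S] have no edge
    between them, and one of the two has at most half of all vertices. *)
Lemma good_connected : ~~ bad_cut f -> forall S : {set V}, #|S| <= k ->
  forall x y, x \notin S -> y \notin S ->
    connect [rel a b | [&& edge f a b, a \notin S & b \notin S]] x y.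
Proof.
move=> good S cS x y xS yS; set R := [rel a b | _].
apply: contraNT good => nxy.
pose C := [set z | connect R x z].
have CS z : z \in C -> z \notin S.
  rewrite inE => /connectP[l]; case/lastP: l => [_ ->//|l w].
  by rewrite rcons_path last_rcons => /andP[_ /and3P[_ _ wS]] ->.
have clC a b : a \in C -> b \notin C -> b \notin S -> f [set a; b] != t0.
  move=> aC bC bS; have [aC' bC'] := (aC, bC).
  apply: contraNN bC => fab; have aS := CS a aC.
  move: aC; rewrite !inE => /connect_trans; apply; apply: connect1 => /=.
  rewrite aS bS /edge fab !andbT; apply: contraNneq bC' => <-; exact: aC'.
have cut (X : {set V}) : 0 < #|X| -> 2 * #|X| <= 2 ^ nu ->
    (forall a b, a \in X -> b \notin X -> b \notin S -> f [set a; b] != t0) -> bad_cut f.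
  move=> X1 X2 hX.
  have cXn : #|X| < (2 ^ nu).+1 by rewrite ltnS -cV; apply: max_card.
  apply/exists_inP; exists (Ordinal cXn); first by rewrite inE /= X1.
  apply/exists_inP; exists X; first by rewrite inE.
  apply/exists_inP; exists S; first by rewrite inE.
  apply/forall_inP => i /imsetP[[a b]]; rewrite !inE /= negb_or => /and3P[aX bX bS] ->.
  exact: hX.
have xC : x \in C by rewrite inE.
have [leC|ltC] := leqP (2 * #|C|) (2 ^ nu).
  by apply: (cut C) => //; apply/card_gt0P; exists x.
apply: (cut (~: (C :|: S))).
- by apply/card_gt0P; exists y; rewrite !inE negb_or nxy.
- have : #|~: (C :|: S)| <= #|~: C| by apply: subset_leq_card; rewrite setCS subsetUl.
  by rewrite [#|~: C|]cardsCs setCK cV; move: ltC; clear; lia.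
move=> a b; rewrite !in_setC !in_setU !negb_or negb_and !negbK => /andP[aC aS].
by case/orP => [bC|->//] bS; rewrite setUC; apply: clC.
Qed.

End Good.
End BadEvents.

(** * Choice of the parameters *)

Lemma exp_dominates_cube a b : exists2 t, 3 <= t & (a * t + b) ^ 3 <= 2 ^ (t - 3).
Proof.
(* [2 ^ (6 * y)] is the cube of [(2 ^ y) ^ 2], which is at least [(y + 1) ^ 2]; this quadratic
   dominates the value of [a * t + b]. *)
pose y := 9 * a + b; exists (3 + 6 * y); first exact: leq_addr.
rewrite addKn (_ : 6 * y = y * 2 * 3); last by lia.
rewrite [leqRHS]expnM leq_exp2r // expnM -mulnn.
have hy : y < 2 ^ y by rewrite ltn_expl.
by apply: leq_trans (leq_mul hy hy); rewrite /y; nia.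
Qed.

Lemma saturated_graph_exists s K k : 0 < s -> exists H : graph,
  [/\ extension_prop (@gadj H) s K, sparse_prop (@gadj H) s K 0,
      triangle_prop (@gadj H) s & kconnected H k].
Proof.
move=> s_gt0; wlog leK : K / s <= K.
  move=> h; have [H [ext spa tri kc]] := h (maxn s K) (leq_maxl _ _).
  have leK := leq_maxr s K; exists H; split=> //.
    by move=> W B sB cB cW; apply: ext => //; apply: leq_trans leK.
  by move=> W cW; apply: spa; apply: leq_trans leK.
(* [K * s + 1] is the coefficient of [tau] in [nu], so the base of the cube is linear in [tau] while
   [L] is exponential in it. *)
have [tau tau3 big] := exp_dominates_cube (K * s + 1)
  ((K + 2 ^ K + K + 3) * s + k + K + s + 20).
have [rho rhoE] : exists rho, rho = tau.+1 * K + 2 ^ K + K + 3 by eexists.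
have [nu nuE] : exists nu, nu = rho * s + tau by eexists.
have [r rE] : exists r, r = 2 ^ rho by eexists.
have [L LE] : exists L, L = 2 ^ (tau - 3) by eexists.
have {}big : (nu + k + K + s + 20) ^ 3 <= L.
  rewrite LE; apply: leq_trans big; rewrite leq_exp2r // nuE rhoE.
  by move: (2 ^ K) => x; clear; lia.
have [n nE] : exists n, n = 2 ^ nu by eexists.
have nL : n = r ^ s * (8 * L).
  rewrite nE nuE rE LE expnD expnM (_ : 8 = 2 ^ 3) //.
  by rewrite -expnD subnKC.
have cV : #|'I_n| = 2 ^ nu by rewrite card_ord.
have cVL : #|'I_n| = r ^ s * (8 * L) by rewrite card_ord.
have cT : #|'I_r| = r by rewrite card_ord.
have r0 : 0 < r by rewrite rE expn_gt0.
pose t0 : 'I_r := Ordinal r0.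
have [|X0 _ cX0] := @exists_subset _ [set: 'I_n] (r ^ s * (4 * L)).
  by rewrite cardsT cVL leq_mul2l leq_mul2r !orbT.
have [f] := exists_not_bad t0 s_gt0 leK big rhoE nuE rE cT cVL cV cX0.
rewrite !negb_or => /and5P[b1 b2 b3 b4 /andP[b5 b6]].
have con := good_connected cV b6.
exists (Graph (@edge_sym _ _ t0 f) (@edge_irr _ _ t0 f)); split.
- exact: good_extension b1.
- exact: good_sparse b5.
- exact: good_triangle b2 b3 b4.
split=> /=.
- rewrite nL; have : 0 < r ^ s by rewrite expn_gt0 r0.
  have : k + 20 <= L.
    apply: leq_trans big; rewrite (leq_trans (_ : _ <= (nu + k + K + s + 20) ^ 1)) //.
      by rewrite expn1; lia.
    by rewrite leq_pexp2l // addnS.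
  by move: (r ^ s) => R; clear; nia.
- move=> x y; have /= := con set0; rewrite cards0 => /(_ isT x y); rewrite !inE => /(_ isT isT).
  apply: connect_sub => a b /= /and3P[ab _ _]; exact: connect1.
- by move=> S cS; apply: con; apply: ltnW.
Qed.

(** * Planting a subgraph *)

Lemma extension_propW (V : finType) (e : rel V) s K K' : K' <= K ->
  extension_prop e s K -> extension_prop e s K'.
Proof. by move=> leK h W B ? ? ?; apply: h => //; apply: leq_trans leK. Qed.

Lemma sparse_propW (V : finType) (e : rel V) s K K' E : K' <= K ->
  sparse_prop e s K 0 -> sparse_prop e s K' E.
Proof.
move=> leK h W cW; apply: leq_trans (h W (leq_trans cW leK)) _.
by rewrite addn0 leq_addr.
Qed.

Section Plant.
Variables (F H : graph) (leFH : gn F <= gn H).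

Let f : 'I_(gn F) -> 'I_(gn H) := widen_ord leFH.
Let VF : {set 'I_(gn H)} := [set f a | a in 'I_(gn F)].
Let planted x y := [exists a, exists b, [&& f a == x, f b == y & gadj a b]].

Let plant_adj : rel 'I_(gn H) := fun x y => gadj x y || planted x y.

Lemma planted_in x y : planted x y -> (x \in VF) && (y \in VF).
Proof.
by case/existsP => a /existsP[b /and3P[/eqP<- /eqP<- _]]; rewrite !imset_f.
Qed.

Lemma plant_sym : symmetric plant_adj.
Proof.
suff h x y : planted x y -> planted y x.
  by move=> x y; rewrite /plant_adj gsym; congr orb; apply/idP/idP; apply: h.
case/existsP => a /existsP[b /and3P[fa fb ab]].
by apply/existsP; exists b; apply/existsP; exists a; rewrite fa fb gsym.
Qed.

Lemma plant_irr : irreflexive plant_adj.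
Proof.
move=> x; rewrite /plant_adj girr /=; apply/negbTE/negP.
case/existsP => a /existsP[b /and3P[/eqP<- /eqP fba]].
have -> : b = a by case: fba => /ord_inj.
by rewrite girr.
Qed.

Definition plant := Graph plant_sym plant_irr.

Lemma plant_contains : contains F plant.
Proof.
exists f; split=> [a b /(congr1 val) ab|a b ab]; first exact: val_inj.
rewrite /= /plant_adj; apply/orP; right.
by apply/existsP; exists a; apply/existsP; exists b; rewrite !eqxx.
Qed.

Lemma plant_kconnected k : kconnected H k -> kconnected plant k.
Proof.
case=> ltk con kcon; split=> //.
  move=> x y; apply: connect_sub (con x y) => a b ab.
  by apply: connect1; rewrite /= /plant_adj ab.
move=> S cS x y xS yS; apply: connect_sub (kcon S cS x y xS yS) => a b /= /and3P[ab aS bS].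
by apply: connect1; rewrite /= /plant_adj ab aS bS.
Qed.

Lemma card_VF : #|VF| <= gn F.
Proof. by apply: leq_trans (leq_imset_card _ _) _; rewrite card_ord. Qed.

(** Extending over [W :|: VF] keeps the new vertex outside [VF], where no planted edge ends. *)
Lemma plant_extension s K : extension_prop (@gadj H) s (K + gn F) ->
  extension_prop (@gadj plant) s K.
Proof.
move=> ext W B sBW cB cW.
have [|||y /attachedP[yW hy]] := ext (W :|: VF) B.
- exact: subset_trans (subsetUl _ _).
- by [].
- by apply: leq_trans (leq_card_setU _ _).1 _; rewrite leq_add ?card_VF.
exists y; move: yW; rewrite inE negb_or => /andP[yW yF].
apply/attachedP; split=> // a aW; rewrite /= /plant_adj hy ?inE ?aW //.
case: (boolP (planted y a)) => [/planted_in|_]; last by rewrite orbF.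
by rewrite (negbTE yF).
Qed.

(** Planted edges lie inside [VF], so each vertex of [VF] gains at most [#|VF|] neighbours and the
    other vertices none. *)
Lemma plant_sparse s K : sparse_prop (@gadj H) s K 0 ->
  sparse_prop (@gadj plant) s K (gn F * gn F).
Proof.
move=> spa W cW; have := spa W cW; rewrite addn0 => h.
apply: leq_trans (leq_add h (leq_mul card_VF card_VF)).
rewrite /degree_sum.
have -> : #|VF| * #|VF| = \sum_(x in VF) #|VF| by rewrite sum_nat_const.
apply: leq_trans (_ : _ <= \sum_(x in W) #|[set y in W | @gadj H x y]| +
   \sum_(x in W | x \in VF) #|VF|) _; last first.
  rewrite leq_add2l; rewrite (eq_bigl (mem (W :&: VF))); last by move=> x; rewrite /= inE.
  by rewrite !sum_nat_const leq_mul2r subset_leq_card ?orbT ?subsetIr.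
rewrite big_mkcondr -big_split /=; apply: leq_sum => x _.
have sub : [set y in W | plant_adj x y] \subset
    [set y in W | @gadj H x y] :|: (if x \in VF then VF else set0).
  apply/subsetP => y; rewrite !inE /plant_adj => /andP[-> /orP[->//|/planted_in/andP[-> ->]]].
  by rewrite orbT.
apply: leq_trans (subset_leq_card sub) _; apply: leq_trans (leq_card_setU _ _).1 _.
by case: ifP; rewrite ?cards0.
Qed.

Lemma plant_triangle s : triangle_prop (@gadj H) s -> triangle_prop (@gadj plant) s.
Proof.
move=> tri A cA; have [x [y [z [[xA yA zA] [xy yz xz]]]]] := tri A cA.
have sub u v : gadj u v -> plant_adj u v by rewrite /plant_adj => ->.
have dom u : dominates (@gadj H) A u -> dominates plant_adj A u.
  by move=> /dominatesP uA; apply/dominatesP => a /uA /sub.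
by exists x, y, z; split; split; [exact: dom|exact: dom|exact: dom|exact: sub..].
Qed.

End Plant.

(** * Copies of [F] and the lower bound on the depth *)

Lemma card_arcs (F : graph) :
  \sum_a #|[set b | @gadj F a b]| = 2 * ne F.
Proof.
have -> : \sum_a #|[set b | @gadj F a b]| =
    #|[set p : 'I_(gn F) * 'I_(gn F) | gadj p.1 p.2]|.
  rewrite -sum1dep_card -(pair_big_dep xpredT (fun a b => gadj a b) (fun _ _ => 1)) /=.
  by apply: eq_bigr => a _; rewrite sum1dep_card.
pose up := [set p : 'I_(gn F) * 'I_(gn F) | (val p.1 < val p.2) && gadj p.1 p.2].
pose sw (p : 'I_(gn F) * 'I_(gn F)) := (p.2, p.1).
have -> : [set p : 'I_(gn F) * 'I_(gn F) | gadj p.1 p.2] = up :|: [set sw p | p in up].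
  apply/setP => -[a b]; rewrite !inE /=; apply/idP/idP => [ab|/orP[/andP[]//|/imsetP[[c d]]]].
    case: (ltngtP a b) => [ltab|ltba|eqab].
    - by rewrite ab.
    - by rewrite /=; apply/imsetP; exists (b, a); rewrite ?inE //= ltba gsym.
    - by move: ab; rewrite (val_inj eqab) girr.
  by rewrite inE /= => /andP[_ cd] [-> ->]; rewrite gsym.
rewrite cardsU (eqP (_ : up :&: _ == set0)) ?cards0 ?subn0; last first.
  rewrite setI_eq0 disjoints_subset; apply/subsetP => -[a b]; rewrite !inE /= => /andP[ab _].
  apply/imsetP => -[[c d]]; rewrite inE /= => /andP[cd _] [ad bc].
  by move: cd; rewrite -bc -ad; apply/negP; rewrite -leqNgt ltnW.
by rewrite card_imset ?mul2n ?addnn // => -[a b] [c d] [-> ->].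
Qed.

(** The vertex set of a copy would have degree sum at least [2 * ne F], beyond the sparsity bound
    [2 * s * nv F]. *)
Lemma sparse_free (F H : graph) s K : sparse_prop (@gadj H) s K 0 -> gn F <= K ->
  s * nv F < ne F -> ~ contains F H.
Proof.
move=> spa leK lte [f [finj fadj]].
pose S := [set f a | a in 'I_(gn F)].
have cS : #|S| = gn F by rewrite card_imset // card_ord.
have := spa S; rewrite cS => /(_ leK); apply/negP; rewrite -ltnNge addn0.
apply: leq_trans (_ : 2 * ne F <= _).
  by rewrite -mulnA ltn_pmul2l.
rewrite -card_arcs /degree_sum big_imset /=; last by move=> ? ? _ _; apply: finj.
apply: leq_sum => a _; rewrite -(card_imset _ finj); apply: subset_leq_card.
apply/subsetP => y /imsetP[b]; rewrite inE => ab ->.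
by rewrite inE fadj // imset_f.
Qed.

Lemma depth_lower_bound (F : graph) s k Phi : 0 < s -> s * nv F < ne F ->
  sentence Phi -> defines_containment_kappa F Phi k -> s.+2 < qd Phi.
Proof.
move=> s_gt0 lte senP defP; rewrite ltnNge; apply/negP => qdP.
pose E := gn F * gn F; pose K := 2 * s + 3 * (2 * s * (2 * s) + E).+1.
(* The summand [gn F] covers the loss in [plant_extension]; connectivity [gn F] ensures enough
   vertices for planting. *)
have [H [ext spa tri kcon]] := saturated_graph_exists (K + gn F) (maxn k (gn F)) s_gt0.
have leKF := leq_addr (gn F) K.
have leFH : gn F <= gn H.
  by case: kcon => lt _ _; apply: leq_trans (leq_maxr k _) (ltnW lt).
have kconH : kconnected H k.
  case: kcon => lt con kc; split=> //; first exact: leq_ltn_trans (leq_maxl _ _) lt.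
  by move=> S cS; apply: kc; apply: leq_trans cS (leq_maxl _ _).
have kconG := plant_kconnected leFH kconH.
have satH : saturated (@gadj H) s K E.
  by split=> //; [exact: extension_propW ext|exact: sparse_propW spa].
have satG : saturated (@gadj (plant leFH)) s K E.
  split=> //; first exact: plant_extension.
    apply: plant_sparse; exact: sparse_propW spa.
  exact: plant_triangle.
have conG : gconnected (plant leFH) by case: kconG.
have conH : gconnected H by case: kconH.
have := saturated_models s_gt0 satG satH senP qdP.
move/(_ ((defP _ conG kconG).2 (plant_contains leFH)))/(defP _ conH kconH).1.
exact: sparse_free spa (leq_addl _ _) lte.
Qed.

Import GRing.Theory Num.Theory Order.TTheory.
Local Open Scope ring_scope.

(* D_kappa(F) >= e(F)/v(F) + 2: every sentence that, for some k, defines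
   F-containment on connected graphs with kappa >= k has depth >= e/v + 2. *)
Theorem theorem12 (F : graph) :
  gconnected F -> (nv F < ne F)%N ->
  forall (Phi : fo) (k : nat), sentence Phi ->
    defines_containment_kappa F Phi k ->
    (ne F)%:R / (nv F)%:R + 2 <= (qd Phi)%:R :> rat.
Proof.
move=> _ lt_ve Phi k senP defP; rewrite leNgt; apply/negP => ltq.
have v_gt0 : (0 < nv F)%N.
  rewrite lt0n; apply: contraTneq lt_ve => v0; rewrite -leqNgt.
  by apply: leq_trans (max_card _) _; rewrite card_prod card_ord -/(nv F) v0.
have v_gt0' : 0 < (nv F)%:R :> rat by rewrite ltr0n.
(* Up to depth 3 the hypothesis on [F] allows [s = 1]. Beyond, [s = qd Phi - 2] is positive, and the
   inequality assumed for contradiction says that [s * nv F < ne F]. *)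
have [q3|q3] := leqP (qd Phi) 3.
  have := @depth_lower_bound F 1 k Phi; rewrite mul1n => /(_ isT lt_ve senP defP).
  by rewrite ltnNge q3.
have := @depth_lower_bound F (qd Phi - 2) k Phi.
have -> : (qd Phi - 2).+2 = qd Phi by lia.
rewrite ltnn => h; suff : false by []; apply: h => //; first by lia.
move: ltq; rewrite -ltrBlDr ltr_pdivlMr // -natrB; last by lia.
by rewrite -natrM ltr_nat.
Qed.
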